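(* Let $\{Y^f_\mu(t)\}_{t\ge0}$, $Y^f_\mu(t)=Y^f(G_\mu(t))$, be the geometric subordinated compound Poisson process with jumps distributed as $X$, Bernstein function $f$, Poisson intensity $\lambda>0$ and geometric parameter $\mu>0$. Then for $t\ge 0$ and $u>0$, $$\mathbb{E}[e^{-uY^f_\mu(t)}]=\frac{1}{1+\mu t\left(1-e^{-f(\lambda(1-M_X(-u)))}\right)},$$ where $M_X(-u)=\mathbb{E}[e^{-uX}]$.
   Context: $\{D^f(t)\}_{t\ge0}$ is a Lévy subordinator (non-decreasing Lévy process) with Laplace transform $\mathbb{E}[e^{-sD^f(t)}]=e^{-tf(s)}$, where $f(s)=bs+\int_0^\infty(1-e^{-sx})\,\nu(dx)$, $b\ge0$, is a Bernstein function, and $\nu$ is a Lévy measure on the positive half-line with $\int_0^\infty (x\wedge 1)\,\nu(dx)<\infty$ and infinite total mass. $\{N(t)\}_{t\ge0}$ is a homogeneous Poisson process with intensity $\lambda>0$, independent of $D^f$, and $N^f(t)=N(D^f(t))$ is the subordinated Poisson process. $X_1,X_2,\dots$ are i.i.d. random variables (jumps) with common distribution function $F_X$, distributed as $X$ and independent of $N^f$. The generalized compound Poisson process is $Y^f(t)=\sum_{i=1}^{N^f(t)}X_i$ (empty sum $=0$). The geometric counting process $\{G_\mu(t)\}_{t\ge0}$ with parameter $\mu>0$ is the mixed Poisson process whose random rate is exponentially distributed with mean $\mu$, so $\mathbb{P}[G_\mu(t)=k]=\frac{1}{1+\mu t}\left(\frac{\mu t}{1+\mu t}\right)^k$, $k=0,1,2,\dots$.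 The geometric subordinated compound Poisson process is $Y^f_\mu(t)=Y^f(G_\mu(t))$ with $G_\mu$ independent of $Y^f$.
   Formalization: The formal theorem additionally assumes that E[exp(-u Y^f_mu(t))] is finite; with signed jumps the identity can fail otherwise (the right side may be negative or undefined). For nonnegative jumps, and for t = 0, this holds automatically. *)

(* Defs.v *)
From mathcomp Require Export all_boot all_order all_algebra.
From mathcomp Require Export all_classical all_reals all_analysis.
Export Order.TTheory GRing.Theory Num.Theory.
Export numFieldNormedType.Exports.

Set Implicit Arguments.
Unset Strict Implicit.
Unset Printing Implicit Defensive.

Local Open Scope classical_set_scope.
Local Open Scope ring_scope.

Section independence.
Context (d : measure_display) (T : measurableType d) (R : realType)
  (P : probability T R).

Definition mutually_independent (I : choiceType) (Z : I -> T -> R) : Prop :=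
  forall (s : seq I) (B : I -> set R), uniq s -> (forall i, measurable (B i)) ->
    (P (\bigcap_(i in [set` s]) (Z i @^-1` B i)) =
     \prod_(i <- s) P (Z i @^-1` B i))%E.

Definition sigma_of_family (d' : measure_display) (U : measurableType d')
    (I : Type) (J : set I) (Z : I -> T -> U) : set (set T) :=
  <<s \bigcup_(i in J) preimage_set_system setT (Z i) measurable >>.

Definition independent_sigma (F H : set (set T)) : Prop :=
  forall A B, F A -> H B -> (P (A `&` B) = P A * P B)%E.

End independence.

(* Processes are indexed by all of R, but only their values at times t >= 0 are
   ever constrained or used. *)
Definition times {R : realType} : set R := [set t | 0 <= t].

Section processes.
Context (d : measure_display) (T : measurableType d) (R : realType)
  (P : probability T R).

Definition independent_increments (Z : R -> T -> R) : Prop :=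
  forall tau : nat -> R, 0 <= tau 0%N -> (forall i, tau i <= tau i.+1) ->
    mutually_independent P (fun i w => Z (tau i.+1) w - Z (tau i) w).

Definition stationary_increments (Z : R -> T -> R) : Prop :=
  forall s h (A : set R), 0 <= s -> 0 <= h -> measurable A ->
    P ((fun w => Z (s + h) w - Z s w) @^-1` A) = P (Z h @^-1` A).

Definition right_continuous_paths (Z : R -> T -> R) : Prop :=
  forall w t, 0 <= t -> Z s w @[s --> t^'+] --> Z t w.

Definition left_limits (Z : R -> T -> R) : Prop :=
  forall w t, 0 < t -> cvg (Z s w @[s --> t^'-]).

Record levy_process (Z : R -> {RV P >-> R}) : Prop := LevyProcess {
  levy_start : forall w, Z 0 w = 0 ;
  levy_independent : independent_increments Z ;
  levy_stationary : stationary_increments Z ;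
  levy_right_continuous : right_continuous_paths Z ;
  levy_left_limits : left_limits Z }.

Record levy_subordinator (D : R -> {RV P >-> R}) : Prop := LevySubordinator {
  subordinator_levy : levy_process D ;
  subordinator_nondecreasing :
    forall w s t, 0 <= s -> s <= t -> D s w <= D t w }.

Record counting_process (N : R -> {RV P >-> nat}) : Prop := CountingProcess {
  counting_start : forall w, N 0 w = 0%N ;
  counting_nondecreasing :
    forall w s t, 0 <= s -> s <= t -> (N s w <= N t w)%N ;
  counting_right_continuous : right_continuous_paths (fun t w => (N t w)%:R) }.

(* The times are strictly ordered because [poisson_pmf 0 k] is not the mass
   function of the Dirac measure at 0 (it is 1 for every k). *)
Record poisson_process (lambda : R) (N : R -> {RV P >-> nat}) : Prop :=
  PoissonProcess {
  poisson_counting : counting_process N ;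
  poisson_independent : independent_increments (fun t w => (N t w)%:R) ;
  poisson_increments : forall s t k, 0 <= s -> s < t ->
    P [set w | (N t w - N s w)%N = k] =
    (poisson_pmf (lambda * (t - s)) k)%:E }.

(* Mixed Poisson process with random rate [L]: conditionally on L = x, the
   increments of [G] are those of a Poisson process with rate x.  The conditional
   statement is written in integrated form, against the law of [L]. *)
Record mixed_poisson_process (L : {RV P >-> R}) (G : R -> {RV P >-> nat}) : Prop :=
  MixedPoissonProcess {
  mixed_counting : counting_process G ;
  mixed_rate_gt0 : P (L @^-1` `]0, +oo[) = 1%E ;
  mixed_increments : forall (n : nat) (tau : nat -> R) (k : nat -> nat)
      (B : set R),
    0 <= tau 0%N -> (forall i, tau i < tau i.+1) -> measurable B ->
    P (L @^-1` B `&`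
       [set w | forall i, (i < n)%N ->
                  (G (tau i.+1) w - G (tau i) w)%N = k i]) =
    (\int[distribution P L]_(x in B)
       (\prod_(i < n) poisson_pmf (x * (tau i.+1 - tau i)) (k i))%:E)%E }.

(* The exponential law with mean mu has rate mu^-1. *)
Definition geometric_counting_process (mu : R) (G : R -> {RV P >-> nat}) : Prop :=
  exists L : {RV P >-> R},
    (forall A : set R, measurable A ->
       distribution P L A = exponential_prob mu^-1 A) /\
    mixed_poisson_process L G.

Definition iid_copies (X : {RV P >-> R}) (Xs : nat -> {RV P >-> R}) : Prop :=
  mutually_independent P Xs /\
  forall i (A : set R), measurable A -> distribution P (Xs i) A = distribution P X A.

Definition subordinated_poisson (N : R -> T -> nat) (D : R -> T -> R)
  (t : R) (w : T) : nat := N (D t w) w.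

(* Jumps are numbered from 0. *)
Definition compound_process (Nf : R -> T -> nat) (Xs : nat -> T -> R)
  (t : R) (w : T) : R := \sum_(i < Nf t w) Xs i w.

Definition geometric_subordinated (Yf : R -> T -> R) (G : R -> T -> nat)
  (t : R) (w : T) : R := Yf (G t w)%:R w.

End processes.

Section bernstein.
Context (R : realType).

Record levy_measure_halfline (nu : {measure set R -> \bar R}) : Prop :=
  LevyMeasureHalfline {
  levy_measure_support : nu `]-oo, 0]%classic = 0%E ;
  levy_measure_integral :
    (\int[nu]_(x in `]0%R, +oo[) (Num.min x 1)%:E < +oo)%E }.

(* For s >= 0 the integral converges.  For s < 0 it may diverge, and the real-valued
   integral is then the default value 0. *)
Definition bernstein (b : R) (nu : {measure set R -> \bar R}) (s : R) : R :=
  b * s + \int[nu]_(x in `]0, +oo[) (1 - expR (- (s * x))).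

End bernstein.

(* Main.v *)
From HB Require Import structures.
Require Import Defs.
From mathcomp Require Import measurable_realfun ring lra.

(* Conditioning on [G t = k] and on [N (D k) = n], with M = E exp(-u X), gives
   E exp(-u Y_mu(t)) = sum_k P(G t = k) E exp(lambda (M - 1) D_k), and the sum is
   geometric as soon as E exp(-s D_k) = exp(-k f(s)) for s = lambda (1 - M).  When
   M <= 1 this is the hypothesis on D.  When M > 1, s is negative and the formula has
   to be continued.  On s > 0 differentiation gives
     E[D exp(-sD)] = k (b + int x exp(-sx) nu(dx)) E exp(-sD),
   an identity between integrals of exponentials with positive weights.  It extends to
   every real s, in [0, +oo], because exp(ax) is the increasing limit of
   sum_(j < m) (a 2^m (1 - exp(-x / 2^m)))^j / j!, a combination of the exp(-sx) with
   s >= 0.  Below a finite exponential moment it is a linear differential equation for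
   s |-> E exp(-sD), whose solution is exp(-k f(s)); monotone convergence reaches the
   endpoint. *)

Set Implicit Arguments.
Unset Strict Implicit.
Unset Printing Implicit Defensive.

Local Open Scope classical_set_scope.
Local Open Scope ring_scope.

(** * Exponentials with negative argument as limits of Laplace kernels *)

(** The jumps are real-valued, so M may exceed 1, and at s = lambda (1 - M) < 0 both E exp(-sD) and
    the integral defining f(s) could diverge; a divergent [bernstein] would take a default value and
    the formula would be meaningless. All finiteness is drawn from the one expectation assumed
    finite. For t > 0 every P(G t = k) is positive, so each E exp(-u Y^f(k)) is finite; N^f(1) >= 1
    has positive probability because f(lambda) > 0, so M is finite; hence E exp(-s D_k) is finite.
    What remains is to show that an exponential moment of D forces one on nu. This is why the
    differentiated identity is the one that is extended: differentiation replaces 1 - exp(-sx),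
    whose sign depends on s, by the positive weight x exp(-sx), so that the two sides can be
    compared before either is known to be finite. *)

Section laplace_exponential.
Context {R : realType}.
Implicit Types a x : R.

(** The difference quotient (1 - exp(-hx)) / h at h = 2^-m, which increases to x. Halving h keeps
    all exponents on nested grids and makes monotonicity an algebraic identity. *)
Definition slope_approx m x : R := 2 ^+ m * (1 - expR (- (x / 2 ^+ m))).

Definition exp_approx a m x : R :=
  series (exp_coeff (a * slope_approx m x)) m.

(** The indeterminate stands for exp(-x / 2^m), so that its i-th power is the Laplace kernel at the
    point i / 2^m >= 0. *)
Definition exp_approx_poly a m : {poly R} :=
  \sum_(j < m) ((a * 2 ^+ m) ^+ j / j`!%:R) *: (1 - 'X) ^+ j.

Lemma exp_approxE a m x : exp_approx a m x =
  \sum_(i < size (exp_approx_poly a m))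
    (exp_approx_poly a m)`_i * expR (- (i%:R / 2 ^+ m) * x).
Proof.
transitivity ((exp_approx_poly a m).[expR (- (x / 2 ^+ m))]).
  rewrite /exp_approx_poly horner_sum /exp_approx /series/= big_mkord.
  apply: eq_bigr => j _.
  rewrite /exp_coeff /= /slope_approx hornerZ horner_exp !hornerE /= exprMn; ring.
rewrite horner_coef; apply: eq_bigr => i _.
by rewrite -expRM_natl; congr (_ * expR _); ring.
Qed.

Lemma slope_approx_ge0 m x : 0 <= x -> 0 <= slope_approx m x.
Proof.
move=> x0; rewrite mulr_ge0 ?exprn_ge0// subr_ge0 -[leRHS]expR0 ler_expR.
by rewrite oppr_le0 divr_ge0// exprn_ge0.
Qed.

(** With e = exp(-x / 2^(m+1)), consecutive terms differ by 2^m (1 - e)^2. *)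
Lemma slope_approx_nd x : nondecreasing_seq (slope_approx ^~ x).
Proof.
apply/nondecreasing_seqP => m; rewrite /slope_approx.
have -> : - (x / 2 ^+ m) = 2%:R * - (x / 2 ^+ m.+1).
  by rewrite exprS; field; rewrite expf_neq0.
rewrite expRM_natl expr2 exprS; set e := expR _.
have m0 : (0 : R) <= 2 ^+ m by rewrite exprn_ge0.
rewrite -mulrA mulrCA ler_wpM2l// -subr_ge0.
have -> : 2 * (1 - e) - (1 - e * e) = (1 - e) ^+ 2 by ring.
exact: sqr_ge0.
Qed.

Lemma slope_approx_le m x : slope_approx m x <= x.
Proof.
have m0 : (0 : R) < 2 ^+ m by rewrite exprn_gt0.
rewrite /slope_approx -ler_pdivlMl// [leRHS]mulrC.
by have := expR_ge1Dx (- (x / 2 ^+ m)); lra.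
Qed.

(** From exp(y) >= 1 + y follows 1 - exp(-y) >= y / (1 + y), here at y = x / 2^m. *)
Lemma slope_approx_ge m x : 0 <= x -> x / (1 + x / 2 ^+ m) <= slope_approx m x.
Proof.
move=> x0; have m0 : (0 : R) < 2 ^+ m by rewrite exprn_gt0.
set y := x / 2 ^+ m; have y0 : 0 <= y by rewrite divr_ge0// ltW.
have xE : x = 2 ^+ m * y by rewrite mulrC divfK// gt_eqF.
rewrite /slope_approx -/y {1}xE -mulrA ler_wpM2l ?(ltW m0)// expRN.
have y1 : 0 < 1 + y by rewrite ltr_pwDl.
have : (expR y)^-1 <= (1 + y)^-1.
  by rewrite lef_pV2 ?posrE ?expR_gt0// expR_ge1Dx.
have -> : y / (1 + y) = 1 - (1 + y)^-1 by field; rewrite gt_eqF.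
lra.
Qed.

Lemma slope_approx_cvg x : 0 <= x -> slope_approx ^~ x @ \oo --> x.
Proof.
move=> x0.
apply: (@squeeze_cvgr _ _ _ _ (fun m => x / (1 + x / 2 ^+ m)) (cst x)).
- by apply: nearW => m; rewrite slope_approx_ge//= slope_approx_le.
- rewrite -[X in _ --> X]mulr1; apply: cvgM; first exact: cvg_cst.
  rewrite -[X in _ --> X]invr1; apply: cvgV => //.
  rewrite -[X in _ --> X]addr0; apply: cvgD; first exact: cvg_cst.
  have -> : (fun m => x / 2 ^+ m) = geometric x 2^-1.
    by apply/funext => m; rewrite /= exprVn.
  by apply: cvg_geometric; rewrite ger0_norm// invf_lt1// ltr1n.
- exact: cvg_cst.
Qed.

Lemma exp_coeff_le x y n : 0 <= x -> x <= y -> exp_coeff x n <= exp_coeff y n.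
Proof.
move=> x0 xy; rewrite /exp_coeff/= ler_wpM2r ?invr_ge0//.
by rewrite lerXn2r// nnegrE// (le_trans x0).
Qed.

Lemma series_exp_coeff_le x n : 0 <= x -> series (exp_coeff x) n <= expR x.
Proof.
move=> x0; apply: nondecreasing_cvgn_le; last exact: is_cvg_series_exp_coeff.
apply/nondecreasing_seqP => k.
by rewrite /series/= big_nat_recr//= lerDl exp_coeff_ge0.
Qed.

Lemma exp_approx_ge0 a m x : 0 <= a -> 0 <= x -> 0 <= exp_approx a m x.
Proof.
move=> a0 x0; rewrite /exp_approx /series/= sumr_ge0// => i _.
by rewrite exp_coeff_ge0// mulr_ge0// slope_approx_ge0.
Qed.

Lemma exp_approx_nd a x : 0 <= a -> 0 <= x ->
  nondecreasing_seq (fun m => exp_approx a m x).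
Proof.
move=> a0 x0; apply/nondecreasing_seqP => m.
rewrite /exp_approx /series/= big_nat_recr//=.
apply: (@le_trans _ _ (\sum_(0 <= k < m) exp_coeff (a * slope_approx m.+1 x) k)).
  apply: ler_sum => i _; apply: exp_coeff_le.
    by rewrite mulr_ge0// slope_approx_ge0.
  by rewrite ler_wpM2l// slope_approx_nd.
by rewrite lerDl exp_coeff_ge0// mulr_ge0// slope_approx_ge0.
Qed.

(** The index m governs both the slope and the number of terms. For the lower bound the two are
    separated: k terms converge by continuity of powers, and from m = k on the approximation
    contains at least these k terms. *)
Lemma exp_approx_cvg a x : 0 <= a -> 0 <= x ->
  exp_approx a ^~ x @ \oo --> expR (a * x).
Proof.
move=> a0 x0; have nd := exp_approx_nd a0 x0.
have ub m : exp_approx a m x <= expR (a * x).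
  rewrite (le_trans (series_exp_coeff_le _ _))//.
    by rewrite mulr_ge0// slope_approx_ge0.
  by rewrite ler_expR ler_wpM2l// slope_approx_le.
have cv : cvgn (exp_approx a ^~ x).
  by apply: nondecreasing_is_cvgn => //; exists (expR (a * x)) => _ [m _ <-].
suff -> : expR (a * x) = limn (exp_approx a ^~ x) by [].
apply/eqP; rewrite eq_le; apply/andP; split; last first.
  by apply: limr_le => //; exact: nearW.
rewrite [leLHS](_ : _ = limn (series (exp_coeff (a * x)))) //.
apply: limr_le; first exact: is_cvg_series_exp_coeff.
apply: nearW => k.
have ck : (fun m => series (exp_coeff (a * slope_approx m x)) k) @ \oo -->
    series (exp_coeff (a * x)) k.
  rewrite /series/=; apply: cvg_big => //; first exact: add_continuous.
  move=> i _; rewrite /exp_coeff/=; apply: cvgMl.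
  apply: (@cvg_comp _ _ _ (fun m => a * slope_approx m x) (fun y => y ^+ i) _ (nbhs (a * x))).
    by apply: cvgMr; exact: slope_approx_cvg.
  exact: exprn_continuous.
rewrite -(cvg_lim _ ck)//; apply: ler_lim; [exact: cvgP ck|by []|].
near=> m; rewrite /exp_approx.
have km : (k <= m)%N by near: m; exists k.
rewrite /series/= [leRHS](big_cat_nat (leq0n k) km)/= lerDl sumr_ge0// => i _.
by rewrite exp_coeff_ge0// mulr_ge0// slope_approx_ge0.
Unshelve. all: by end_near. Qed.

End laplace_exponential.

(** * Exponential integrals recovered from the Laplace transform on s >= 0 *)

Section laplace_extrapolation.
Context {R : realType}.
Implicit Types (a : R) (F : R -> R).

(** What [exp_approx] becomes after integration when F is a Laplace transform. It reads F only at
    points s >= 0 and is linear in F, so an identity between transforms on s >= 0 carries over to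
    the extrapolations. *)
Definition extrapolate a m F : R :=
  \sum_(i < size (exp_approx_poly a m))
    (exp_approx_poly a m)`_i * F (i%:R / 2 ^+ m).

Section one_measure.
Context d (T : measurableType d) (mu : {measure set T -> \bar R}).
Context (E : set T) (mE : measurable E) (W X : T -> R) (F : R -> R).
Hypothesis mW : measurable_fun E W.
Hypothesis mX : measurable_fun E X.
Hypothesis W_ge0 : forall w, E w -> 0 <= W w.
Hypothesis X_ge0 : forall w, E w -> 0 <= X w.
Hypothesis F_laplace : forall s, 0 <= s ->
  (\int[mu]_(w in E) (W w * expR (- s * X w))%:E = (F s)%:E)%E.

Let mexp c : measurable_fun E (fun w => expR (c * X w)).
Proof. by apply: measurableT_comp => //; exact: measurable_funM. Qed.

Lemma integrable_laplace s : 0 <= s ->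
  mu.-integrable E (fun w => (W w * expR (- s * X w))%:E).
Proof.
move=> s0; apply/integrableP; split.
  by apply/measurable_EFinP; apply: measurable_funM.
under eq_integral => w /set_mem Ew.
  rewrite gee0_abs; last by rewrite lee_fin mulr_ge0 ?expR_ge0 ?W_ge0.
  over.
by rewrite F_laplace// ltry.
Qed.

(** The coefficients of the polynomial have varying signs, so linearity is used through
    integrability of each kernel, which finiteness of F on s >= 0 provides. *)
Lemma integral_exp_approx a m :
  (\int[mu]_(w in E) (W w * exp_approx a m (X w))%:E = (extrapolate a m F)%:E)%E.
Proof.
have int_i (i : nat) := @integrable_laplace (i%:R / 2 ^+ m)
  (divr_ge0 (ler0n _ i) (exprn_ge0 m (ler0n _ 2))).
pose p := exp_approx_poly a m.
transitivity (\int[mu]_(w in E) (\sum_(i < size p)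
   (p`_i)%:E * (W w * expR (- (i%:R / 2 ^+ m) * X w))%:E))%E.
  apply: eq_integral => w _; rewrite exp_approxE mulr_sumr -sumEFin.
  by apply: eq_bigr => i _; rewrite -EFinM mulrCA.
rewrite integral_sum//; last by move=> i; exact: integrableZl.
rewrite /extrapolate -sumEFin; apply: eq_bigr => i _.
rewrite integralZl// F_laplace ?EFinM//.
Qed.

Lemma measurable_exp_approx a m : measurable_fun E (fun w => exp_approx a m (X w)).
Proof.
under eq_fun do rewrite exp_approxE.
by apply: measurable_sum => i; exact: measurable_funM.
Qed.

(** Monotone convergence: the approximants are nonnegative and increase with m, so the limit is
    correct even when it is +oo. *)
Lemma extrapolate_cvg a : 0 <= a ->
  (extrapolate a m F)%:E @[m --> \oo] -->
  (\int[mu]_(w in E) (W w * expR (a * X w))%:E)%E.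
Proof.
move=> a0; under eq_fun do rewrite -integral_exp_approx.
rewrite (_ : (\int[mu]_(w in E) (W w * expR (a * X w))%:E)%E =
  (\int[mu]_(w in E) limn (fun m => (W w * exp_approx a m (X w))%:E))%E).
  apply: cvg_monotone_convergence => //.
  - by move=> m; apply/measurable_EFinP/measurable_funM => //; exact: measurable_exp_approx.
  - by move=> m w Ew; rewrite lee_fin mulr_ge0 ?W_ge0// exp_approx_ge0// X_ge0.
  - move=> w Ew m n mn; rewrite lee_fin ler_wpM2l ?W_ge0//.
    by apply: exp_approx_nd => //; exact: X_ge0.
apply: eq_integral => w /set_mem Ew; apply/esym/cvg_lim => //.
apply: cvg_EFin; first exact: nearW.
by apply: cvgMr; apply: exp_approx_cvg => //; exact: X_ge0.
Qed.

End one_measure.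

(* Convolution, written as an iterated integral: no product measure is needed
   because the inner integral is a finite combination of exponentials. *)
Section two_measures.
Context d1 (T1 : measurableType d1) (mu1 : {measure set T1 -> \bar R}).
Context d2 (T2 : measurableType d2) (mu2 : {measure set T2 -> \bar R}).
Context (E1 : set T1) (mE1 : measurable E1) (W1 X1 : T1 -> R) (F1 : R -> R).
Context (E2 : set T2) (mE2 : measurable E2) (W2 X2 : T2 -> R) (F2 : R -> R).
Hypothesis mW1 : measurable_fun E1 W1.
Hypothesis mX1 : measurable_fun E1 X1.
Hypothesis W1_ge0 : forall w, E1 w -> 0 <= W1 w.
Hypothesis X1_ge0 : forall w, E1 w -> 0 <= X1 w.
Hypothesis F1_laplace : forall s, 0 <= s ->
  (\int[mu1]_(w in E1) (W1 w * expR (- s * X1 w))%:E = (F1 s)%:E)%E.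
Hypothesis mW2 : measurable_fun E2 W2.
Hypothesis mX2 : measurable_fun E2 X2.
Hypothesis W2_ge0 : forall w, E2 w -> 0 <= W2 w.
Hypothesis X2_ge0 : forall w, E2 w -> 0 <= X2 w.
Hypothesis F2_laplace : forall s, 0 <= s ->
  (\int[mu2]_(w in E2) (W2 w * expR (- s * X2 w))%:E = (F2 s)%:E)%E.

Let inner a m x : R := extrapolate a m (fun s => F2 s * expR (- s * x)).

Let innerE a m x : 0 <= x ->
  (\int[mu2]_(w in E2) (W2 w * exp_approx a m (x + X2 w))%:E = (inner a m x)%:E)%E.
Proof.
move=> x0.
apply: (@integral_exp_approx _ _ mu2 E2 mE2 W2 (fun w => x + X2 w)
  (fun s => F2 s * expR (- s * x))) => //.
- exact: measurable_funD.
- by move=> s s0; under eq_integral do rewrite mulrDr expRD mulrCA EFinM;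
  rewrite integralZl//=; [rewrite F2_laplace// muleC|
  exact: (@integrable_laplace _ _ mu2 E2 W2 X2 F2)].
Qed.

Let inner_ge0 a m x : 0 <= a -> 0 <= x -> 0 <= inner a m x.
Proof.
move=> a0 x0; rewrite -lee_fin -innerE//; apply: integral_ge0 => w Ew.
by rewrite lee_fin mulr_ge0 ?W2_ge0// exp_approx_ge0// addr_ge0// X2_ge0.
Qed.

Let minner a m : measurable_fun E1 (fun w => inner a m (X1 w)).
Proof.
rewrite /inner /extrapolate; apply: measurable_sum => i.
apply: measurable_funM => //; apply: measurable_funM => //.
by apply: measurableT_comp => //; exact: measurable_funM.
Qed.

Let mapprox a m x : measurable_fun E2 (fun w => (W2 w * exp_approx a m (x + X2 w))%:E).
Proof.
apply/measurable_EFinP/measurable_funM => //.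
by apply: (@measurable_exp_approx _ _ E2 (fun w => x + X2 w)); exact: measurable_funD.
Qed.

Let inner_nd a x : 0 <= a -> 0 <= x -> nondecreasing_seq (fun m => inner a m x).
Proof.
move=> a0 x0 m n mn; rewrite -lee_fin -!innerE//.
have x2 w : E2 w -> 0 <= x + X2 w by move=> Ew; rewrite addr_ge0// X2_ge0.
apply: ge0_le_integral => //.
- by move=> w Ew; rewrite lee_fin mulr_ge0 ?W2_ge0// exp_approx_ge0// x2.
- move=> w Ew; rewrite lee_fin ler_wpM2l ?W2_ge0//.
  by apply: exp_approx_nd => //; exact: x2.
Qed.

Let inner_cvg a x : 0 <= a -> 0 <= x ->
  (inner a m x)%:E @[m --> \oo] -->
  ((expR (a * x))%:E * \int[mu2]_(w in E2) (W2 w * expR (a * X2 w))%:E)%E.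
Proof.
move=> a0 x0; rewrite -ge0_integralZl//=; last 2 first.
- apply/measurable_EFinP/measurable_funM => //.
  by apply: measurableT_comp => //; exact: measurable_funM.
- by move=> w Ew; rewrite lee_fin mulr_ge0 ?expR_ge0 ?W2_ge0.
under eq_integral do rewrite -EFinM mulrCA -expRD -mulrDr.
apply: (@extrapolate_cvg _ _ mu2 E2 mE2 W2 (fun w => x + X2 w)
  (fun s => F2 s * expR (- s * x))) => //.
- exact: measurable_funD.
- by move=> w Ew; rewrite addr_ge0 ?X2_ge0.
- by move=> s s0; under eq_integral do rewrite mulrDr expRD mulrCA EFinM;
  rewrite integralZl//=; [rewrite F2_laplace// muleC|
  exact: (@integrable_laplace _ _ mu2 E2 W2 X2 F2)].
Qed.

(** Extrapolation is not multiplicative at fixed m, but F1 F2 is the transform of the sum X1 + X2.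
    For fixed x, the function F2(s) exp(-sx) is the transform of x + X2 and its extrapolation is
    [inner]; monotone convergence is applied to the inner integral and then to the outer one. *)
Lemma extrapolate_mul_cvg a : 0 <= a ->
  (extrapolate a m (fun s => F1 s * F2 s))%:E @[m --> \oo] -->
  ((\int[mu1]_(w in E1) (W1 w * expR (a * X1 w))%:E) *
   (\int[mu2]_(w in E2) (W2 w * expR (a * X2 w))%:E))%E.
Proof.
move=> a0; set I2 := (X in (_ * X)%E).
have I2_ge0 : (0 <= I2)%E.
  by apply: integral_ge0 => w Ew; rewrite lee_fin mulr_ge0 ?expR_ge0 ?W2_ge0.
have outerE m : (extrapolate a m (fun s => F1 s * F2 s))%:E =
    (\int[mu1]_(w in E1) (W1 w * inner a m (X1 w))%:E)%E.
  have s0 (i : nat) : 0 <= i%:R / 2 ^+ m :> R by rewrite divr_ge0// exprn_ge0.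
  pose p := exp_approx_poly a m.
  transitivity (\int[mu1]_(w in E1) (\sum_(i < size p)
     (p`_i * F2 (i%:R / 2 ^+ m))%:E *
     (W1 w * expR (- (i%:R / 2 ^+ m) * X1 w))%:E))%E; last first.
    apply: eq_integral => w _; rewrite /inner /extrapolate mulr_sumr -sumEFin.
    by apply: eq_bigr => i _; rewrite -EFinM; congr EFin; rewrite /p; ring.
  have int_i (i : nat) := @integrable_laplace _ _ mu1 E1 W1 X1 F1 mW1 mX1 W1_ge0
    F1_laplace _ (s0 i).
  rewrite integral_sum//; last by move=> i; exact: integrableZl.
  rewrite /extrapolate -sumEFin; apply: eq_bigr => i _.
  by rewrite integralZl// F1_laplace// -EFinM; congr EFin; rewrite /p; ring.
under eq_fun do rewrite outerE.
rewrite -ge0_integralZr//=; last 2 first.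
- apply/measurable_EFinP/measurable_funM => //.
  by apply: measurableT_comp => //; exact: measurable_funM.
- by move=> w Ew; rewrite lee_fin mulr_ge0 ?expR_ge0 ?W1_ge0.
rewrite (_ : (\int[mu1]_(w in E1) ((W1 w * expR (a * X1 w))%:E * I2))%E =
    (\int[mu1]_(w in E1) limn (fun m => (W1 w * inner a m (X1 w))%:E))%E).
  apply: cvg_monotone_convergence => //.
  - by move=> m; apply/measurable_EFinP/measurable_funM.
  - by move=> m w Ew; rewrite lee_fin mulr_ge0 ?W1_ge0 ?inner_ge0 ?X1_ge0.
  - move=> w Ew m n mn; rewrite lee_fin ler_wpM2l ?W1_ge0//.
    by apply: inner_nd => //; exact: X1_ge0.
apply: eq_integral => w /set_mem Ew; apply/esym/cvg_lim => //.
rewrite EFinM -muleA; under eq_fun do rewrite EFinM.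
by apply: cvgeZl => //; apply: inner_cvg => //; exact: X1_ge0.
Qed.

End two_measures.

End laplace_extrapolation.

(** * Bernstein functions at negative arguments *)

Section exponential_integrals.
Context {R : realType}.
Implicit Types h x : R.

(** A factor x costs an arbitrarily small increase e of the exponent, since e x <= exp(e x). *)
Lemma mul_expR_le (e h x : R) : 0 < e ->
  x * expR (h * x) <= e^-1 * expR ((h + e) * x).
Proof.
move=> e0; rewrite mulrDl expRD mulrCA mulrC ler_wpM2l ?expR_ge0//.
rewrite -ler_pdivrMl ?invr_gt0// invrK.
by have := expR_ge1Dx (e * x); lra.
Qed.

Lemma expRB1_le h x : 0 <= x -> expR (h * x) - 1 <= h * (x * expR (h * x)).
Proof.
move=> x0; have := expR_ge1Dx (- (h * x)); rewrite expRN.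
rewrite -(ler_pM2l (expR_gt0 (h * x))) divff ?gt_eqF ?expR_gt0//.
by move=> H; nra.
Qed.

Lemma is_derive_expRB1 h x :
  is_derive h 1 (fun l => expR (l * x) - 1) (x * expR (h * x)).
Proof.
have -> : (fun l => expR (l * x) - 1) = (expR \o (fun l : R => l * x)) \- cst 1.
  by [].
apply: is_derive_eq.
by rewrite subr0 scaler0 add0r scaler1 mulrC.
Qed.

(** The constant 1 is subtracted so that the statement covers measures of infinite mass such as nu,
    for which exp(hx) itself need not be integrable near x = 0. *)
Lemma is_derive_integral_expRB1 d (T : measurableType d)
    (mu : {measure set T -> \bar R}) (E : set T) (X : T -> R) (q : R) :
  measurable E -> measurable_fun E X -> (forall w, E w -> 0 <= X w) ->
  (forall h, h < q -> mu.-integrable E (fun w => (expR (h * X w) - 1)%:E)) ->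
  (forall h, h < q -> mu.-integrable E (fun w => (X w * expR (h * X w))%:E)) ->
  forall h, h < q ->
  is_derive h 1 (fun l => \int[mu]_(w in E) (expR (l * X w) - 1))
    (\int[mu]_(w in E) (X w * expR (h * X w))).
Proof.
move=> mE mX X0 int0 int1 h hq.
pose f l w := expR (l * X w) - 1.
(* The midpoint of h and q leaves room on both sides: it bounds every exponent near h from above,
   and it is below q, where integrability is assumed. *)
pose G w := `|X w| * expR ((h + q) / 2 * X w).
have Ih : `]h - 1, ((h + q) / 2)[%classic h by rewrite /= in_itv/=; lra.
have lq l : `]h - 1, ((h + q) / 2)[%classic l -> l < q.
  by rewrite /= in_itv/= => /andP[_ ?]; lra.
have intf l : `]h - 1, ((h + q) / 2)[%classic l -> mu.-integrable E (EFin \o f l).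
  by move=> /lq; exact: int0.
have derf l w : `]h - 1, ((h + q) / 2)[%classic l -> E w -> derivable (f^~ w) l 1.
  by move=> _ _; have := is_derive_expRB1 l (X w); case.
have dfE l w : partial1of2 f l w = X w * expR (l * X w).
  by rewrite partial1of2E; have := is_derive_expRB1 l (X w); case.
have G0 w : 0 <= G w by rewrite mulr_ge0 ?expR_ge0.
have intG : mu.-integrable E (EFin \o G).
  apply: (@eq_integrable _ _ _ mu E mE (fun w => (X w * expR ((h + q) / 2 * X w))%:E)).
    by move=> w /set_mem Ew; rewrite /= /G ger0_norm ?X0.
  by apply: int1; lra.
have Gub l w : `]h - 1, ((h + q) / 2)[%classic l -> E w -> `|partial1of2 f l w| <= G w.
  rewrite /= in_itv/= => /andP[_ lh] Ew; rewrite dfE normrM (ger0_norm (expR_ge0 _)).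
  by rewrite ler_wpM2l// ler_expR ler_wpM2r ?X0 ?ltW.
apply: DeriveDef.
  exact: (derivable_under_integral mE Ih intf derf G0 intG Gub).
rewrite -derive1E (differentiation_under_integral mE Ih intf derf G0 intG Gub).
by apply: eq_Rintegral => w _; rewrite dfE.
Qed.

Lemma levy_measure_integrable_min (nu : {measure set R -> \bar R}) :
  levy_measure_halfline nu ->
  nu.-integrable `]0, +oo[%classic (fun x => (Num.min x 1)%:E).
Proof.
move=> nul; apply/integrableP; split.
  by apply/measurable_EFinP; exact: measurable_minr.
under eq_integral => x /set_mem/=.
  rewrite in_itv/= andbT => x0.
  by rewrite ger0_norm ?le_min ?ltW//; over.
exact: levy_measure_integral.
Qed.

Lemma levy_measure_integrable_expRB1 (nu : {measure set R -> \bar R}) h :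
  levy_measure_halfline nu -> h <= 0 ->
  nu.-integrable `]0, +oo[%classic (fun x => (expR (h * x) - 1)%:E).
Proof.
move=> nul h0.
(* For h <= 0, 1 - exp(hx) is at most -h x and at most 1; the factor 1 - h covers both x < 1 and x
   >= 1. *)
apply: (@le_integrable _ _ _ nu _ _ _ (fun x => ((1 - h)%:E * (Num.min x 1)%:E)%E)) => //.
- apply/measurable_EFinP; apply: measurable_funB => //.
  exact: measurableT_comp.
- move=> x; rewrite /= in_itv/= andbT => x0; rewrite lee_fin.
  have e1 : expR (h * x) <= 1.
    by rewrite -[leRHS]expR0 ler_expR mulr_le0_ge0 // ltW.
  have m0 : 0 <= Num.min x 1 by rewrite le_min ltW/=.
  rewrite ler0_norm ?subr_le0// ger0_norm; last by rewrite mulr_ge0//; lra.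
  have := expR_ge1Dx (h * x); have := expR_gt0 (h * x).
  by rewrite minEle; case: ifPn => _ *; nra.
- by apply: integrableZl => //; exact: levy_measure_integrable_min.
Qed.

Lemma levy_measure_integrable_xexpR (nu : {measure set R -> \bar R}) h :
  levy_measure_halfline nu -> h < 0 ->
  nu.-integrable `]0, +oo[%classic (fun x => (x * expR (h * x))%:E).
Proof.
move=> nul h0.
(* The summand 1 serves x < 1, where x exp(hx) <= x; the summand 1 / (-h) serves x >= 1, where x
   exp(hx) <= 1 / (-h). *)
apply: (@le_integrable _ _ _ nu _ _ _ (fun x => ((1 + (- h)^-1)%:E * (Num.min x 1)%:E)%E)) => //.
- apply/measurable_EFinP; apply: measurable_funM => //.
  exact: measurableT_comp.
- move=> x; rewrite /= in_itv/= andbT => x0; rewrite lee_fin.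
  have e1 : expR (h * x) <= 1.
    by rewrite -[leRHS]expR0 ler_expR mulr_le0_ge0 // ltW.
  have m0 : 0 <= Num.min x 1 by rewrite le_min ltW/=.
  have h'0 : 0 < - h by rewrite oppr_gt0.
  have hi0 : 0 < (- h)^-1 by rewrite invr_gt0.
  rewrite ger0_norm; last by rewrite mulr_ge0 ?ltW ?expR_gt0.
  rewrite ger0_norm; last by rewrite mulr_ge0// addr_ge0 ?ltW.
  have := mul_expR_le h x h'0; rewrite subrr mul0r expR0 mulr1.
  have := expR_gt0 (h * x).
  rewrite minEle; case: ifPn => _ *; last lra.
  by apply: (@le_trans _ _ x); nra.
- by apply: integrableZl => //; exact: levy_measure_integrable_min.
Qed.

End exponential_integrals.

(** * The Laplace formula at a negative argument with finite exponential moment *)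

Section bernstein_extension.
Context d (T : measurableType d) (R : realType) (P : probability T R).
Context (D : T -> R) (b t : R) (nu : {measure set R -> \bar R}).
Hypothesis mD : measurable_fun setT D.
Hypothesis D_ge0 : forall w, 0 <= D w.
Hypothesis b_ge0 : 0 <= b.
Hypothesis nu_levy : levy_measure_halfline nu.
Hypothesis t_gt0 : 0 < t.
Hypothesis D_laplace : forall s, 0 <= s ->
  (\int[P]_w (expR (- s * D w))%:E = (expR (- t * bernstein b nu s))%:E)%E.

Local Notation pos := (`]0, +oo[%classic : set (measurableTypeR R)).

Let mexp h : measurable_fun setT (fun w => expR (h * D w)).
Proof. by apply: measurableT_comp => //; exact: measurable_funM. Qed.

Let nu_mexp h : measurable_fun pos (fun x : R => expR (h * x)).
Proof. exact: measurableT_comp. Qed.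

(** The function -f(-h), in the variable h = -s: the target formula reads E exp(hD) = exp(t
    exponent(h)), with h > 0 the case to be reached. *)
Let exponent h := b * h + \int[nu]_(x in pos) (expR (h * x) - 1).

Let exponent_derive h := b + \int[nu]_(x in pos) (x * expR (h * x)).

Let bernsteinE s : nu.-integrable pos (fun x => (expR (- s * x) - 1)%:E) ->
  bernstein b nu s = - exponent (- s).
Proof.
move=> ints; rewrite /exponent mulrN opprD opprK; congr (_ + _).
rewrite /Rintegral -fineN; congr fine; rewrite -integralN; last first.
  exact: integrable_add_def.
by apply: eq_integral => x _; rewrite -EFinN opprB mulNr.
Qed.

Let integral_exp h : h <= 0 ->
  (\int[P]_w (expR (h * D w))%:E = (expR (t * exponent h))%:E)%E.
Proof.
move=> h0; have := @D_laplace (- h); rewrite oppr_ge0 opprK => ->//.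
rewrite bernsteinE opprK ?mulrNN//.
exact: levy_measure_integrable_expRB1.
Qed.

Let integrable_exp h : (\int[P]_w (expR (h * D w))%:E < +oo)%E ->
  P.-integrable setT (fun w => (expR (h * D w))%:E).
Proof.
move=> hoo; apply/integrableP; split; first exact/measurable_EFinP.
by under eq_integral do rewrite gee0_abs ?lee_fin ?expR_ge0//.
Qed.

Let integrable_expRB1 h : P.-integrable setT (fun w => (expR (h * D w))%:E) ->
  P.-integrable setT (fun w => (expR (h * D w) - 1)%:E).
Proof.
move=> hint; under eq_fun do rewrite EFinB.
by apply: integrableB => //; exact: finite_measure_integrable_cst.
Qed.

Let integrable_DexpR e h : 0 < e ->
  P.-integrable setT (fun w => (expR ((h + e) * D w))%:E) ->
  P.-integrable setT (fun w => (D w * expR (h * D w))%:E).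
Proof.
move=> e0 hint; apply: (@le_integrable _ _ _ P _ _ _
  (fun w => (e^-1)%:E * (expR ((h + e) * D w))%:E)%E) => //.
- by apply/measurable_EFinP; exact: measurable_funM.
- move=> w _; rewrite lee_fin !ger0_norm ?mulr_ge0 ?expR_ge0 ?invr_ge0 ?(ltW e0)//.
  exact: mul_expR_le.
- exact: integrableZl.
Qed.

Let integral_expE h : P.-integrable setT (fun w => (expR (h * D w))%:E) ->
  (\int[P]_w (expR (h * D w))%:E = (1 + \int[P]_w (expR (h * D w) - 1))%:E)%E.
Proof.
move=> hint; rewrite RintegralB//; last exact: finite_measure_integrable_cst.
rewrite Rintegral_cst// [X in 1 * X](_ : _ = 1); last first.
  exact: (congr1 fine (probability_setT P)).
rewrite mulr1 addrC subrK fineK//.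
exact: integrable_fin_num.
Qed.

Let integrable_exp_le0 h : h <= 0 ->
  P.-integrable setT (fun w => (expR (h * D w))%:E).
Proof. by move=> h0; apply: integrable_exp; rewrite integral_exp// ltry. Qed.

Let integrable_DexpR_lt0 h : h < 0 ->
  P.-integrable setT (fun w => (D w * expR (h * D w))%:E).
Proof.
move=> h0; apply: (@integrable_DexpR (- h)); first by rewrite oppr_gt0.
by rewrite subrr; exact: integrable_exp_le0.
Qed.

Let is_derive_exponent q h :
  (forall l, l < q -> nu.-integrable pos (fun x => (expR (l * x) - 1)%:E)) ->
  (forall l, l < q -> nu.-integrable pos (fun x => (x * expR (l * x))%:E)) ->
  h < q -> is_derive h 1 exponent (exponent_derive h).
Proof.
move=> int0 int1 hq.
have mid : measurable_fun pos (@id R) by [].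
have id0 (x : R) : pos x -> 0 <= x by rewrite /= in_itv/= andbT => /ltW.
have ? := is_derive_integral_expRB1 (measurable_itv _) mid id0 int0 int1 hq.
rewrite /exponent.
apply: is_derive_eq.
by rewrite /exponent_derive /GRing.scale/= mulr1.
Qed.

Let integral_DexpR_lt0 h : h < 0 ->
  \int[P]_w (D w * expR (h * D w)) =
  t * exponent_derive h * expR (t * exponent h).
Proof.
move=> h0.
have D1 := is_derive_integral_expRB1 measurableT mD (fun w _ => D_ge0 w)
  (fun l (l0 : l < 0) => integrable_expRB1 (integrable_exp_le0 (ltW l0)))
  integrable_DexpR_lt0 h0.
have D2 : is_derive h 1 (fun l => expR (t * exponent l) - 1)
    (t * exponent_derive h * expR (t * exponent h)).
  have ? : is_derive h 1 exponent (exponent_derive h).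
    apply: (@is_derive_exponent 0) => // l l0.
      by apply: levy_measure_integrable_expRB1 => //; exact: ltW.
    exact: levy_measure_integrable_xexpR.
  have -> : (fun l => expR (t * exponent l) - 1) =
      (expR \o (fun l => t * exponent l)) \- cst 1 by [].
  apply: is_derive_eq.
  by rewrite subr0 /GRing.scale/= mulrC.
have [_ <-] := D2; have [_ <-] := D1.
(* The two functions are known to agree only for l <= 0, which is a neighbourhood of h because h < 0
   strictly. *)
apply: near_eq_derive; near=> l.
have l0 : l <= 0 by near: l; exact: lt_le_nbhsl.
have := integral_expE (integrable_exp_le0 l0).
by rewrite integral_exp// => -[->]; rewrite addrAC subrr add0r.
Unshelve. all: by end_near. Qed.

(** At h = 0 the quantities E[D] and int x nu(dx) may already be infinite, so the extrapolation
    starts from the base point -1. Tilting P and nu by exp(-D) and exp(-x) makes all transforms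
    finite on s >= 0, and a = h + 1 leads from the base point to h. The identity at negative
    arguments passes through [extrapolate] by linearity, and its product term converges by
    [extrapolate_mul_cvg]. *)
Let integral_DexpR h : -1 <= h ->
  (\int[P]_w (D w * expR (h * D w))%:E =
   t%:E * (b%:E * \int[P]_w (expR (h * D w))%:E +
   (\int[nu]_(x in pos) (x * expR (h * x))%:E) * \int[P]_w (expR (h * D w))%:E))%E.
Proof.
move=> h1; set a := h + 1; have a0 : 0 <= a by rewrite /a; lra.
pose FD s := \int[P]_w (D w * expR (- (1 + s) * D w)).
pose FC s := expR (t * exponent (- (1 + s))).
pose FJ s := \int[nu]_(x in pos) (x * expR (- (1 + s) * x)).
have s1 s : 0 <= s -> - (1 + s) < 0 by move=> s0; rewrite oppr_lt0 ltr_pwDl.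
have FDE s : 0 <= s -> FD s = t * (b * FC s + FJ s * FC s).
  by move=> s0; rewrite /FD integral_DexpR_lt0 ?s1// /exponent_derive /FC /FJ; ring.
have split (c y : R) : expR (- y) * expR (c * y) = expR ((c - 1) * y).
  by rewrite -expRD; congr expR; ring.
have splits (s y : R) : expR (- y) * expR (- s * y) = expR (- (1 + s) * y).
  by rewrite -expRD; congr expR; ring.
have mDe : measurable_fun setT (fun w => D w * expR (- D w)).
  apply: measurable_funM => //; apply: measurableT_comp => //; exact: measurableT_comp.
have cD : (extrapolate a m FD)%:E @[m --> \oo] -->
    (\int[P]_w (D w * expR (h * D w))%:E)%E.
  rewrite (_ : (\int[P]_w (D w * expR (h * D w))%:E)%E =
    (\int[P]_w ((D w * expR (- D w)) * expR (a * D w))%:E)%E); last first.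
    by apply: eq_integral => w _; rewrite -mulrA split /a addrK.
  apply: extrapolate_cvg => // [w _|s s0]; first by rewrite mulr_ge0 ?expR_ge0.
  rewrite /FD; under eq_integral do rewrite -mulrA splits.
  rewrite fineK//; apply: integrable_fin_num => //; apply: integrable_DexpR_lt0; exact: s1.
have FC_laplace s : 0 <= s ->
    (\int[P]_w (expR (- D w) * expR (- s * D w))%:E = (FC s)%:E)%E.
  by move=> s0; under eq_integral do rewrite splits; rewrite integral_exp ?ltW ?s1.
have FJ_laplace s : 0 <= s ->
    (\int[nu]_(x in pos) ((x * expR (- x)) * expR (- s * x))%:E = (FJ s)%:E)%E.
  move=> s0; rewrite /FJ; under eq_integral do rewrite -mulrA splits.
  rewrite fineK//; apply: integrable_fin_num => //.
  by apply: levy_measure_integrable_xexpR => //; exact: s1.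
have mDe' : measurable_fun setT (fun w => expR (- D w)).
  by apply: measurableT_comp => //; exact: measurableT_comp.
have hE : (\int[P]_w (expR (h * D w))%:E)%E =
    (\int[P]_w (expR (- D w) * expR (a * D w))%:E)%E.
  by apply: eq_integral => w _; rewrite split /a addrK.
have cC : (extrapolate a m FC)%:E @[m --> \oo] -->
    (\int[P]_w (expR (h * D w))%:E)%E.
  by rewrite hE; apply: extrapolate_cvg => // w _; rewrite expR_ge0.
have cJC : (extrapolate a m (fun s => FJ s * FC s))%:E @[m --> \oo] -->
    ((\int[nu]_(x in pos) (x * expR (h * x))%:E) * \int[P]_w (expR (h * D w))%:E)%E.
  rewrite hE (_ : (\int[nu]_(x in pos) (x * expR (h * x))%:E)%E =
    (\int[nu]_(x in pos) ((x * expR (- x)) * expR (a * x))%:E)%E); last first.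
    by apply: eq_integral => w _; rewrite -mulrA split /a addrK.
  apply: extrapolate_mul_cvg => //.
  - apply: measurable_funM => //; apply: measurableT_comp => //.
  - by move=> x; rewrite /= in_itv/= andbT => /ltW x0; rewrite mulr_ge0 ?expR_ge0.
  - by move=> x; rewrite /= in_itv/= andbT => /ltW.
have extE m : (extrapolate a m FD)%:E =
    (t%:E * (b%:E * (extrapolate a m FC)%:E +
     (extrapolate a m (fun s => (FJ s * FC s)%R))%:E))%E.
  rewrite -EFinM; congr EFin.
  rewrite /extrapolate !mulr_sumr -big_split/= mulr_sumr; apply: eq_bigr => i _.
  rewrite FDE; first by ring.
  by rewrite divr_ge0// exprn_ge0.
have C_ge0 : (0 <= \int[P]_w (expR (h * D w))%:E)%E.
  by apply: integral_ge0 => w _; rewrite lee_fin expR_ge0.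
have J_ge0 : (0 <= \int[nu]_(x in pos) (x * expR (h * x))%:E)%E.
  apply: integral_ge0 => x; rewrite /= in_itv/= andbT => /ltW x0.
  by rewrite lee_fin mulr_ge0 ?expR_ge0.
rewrite -(cvg_lim _ cD)//; apply/cvg_lim => //.
under eq_fun do rewrite extE.
apply: cvgeZl => //; apply: cvgeD => //; last exact: cvgeZl.
by rewrite ge0_adde_def// inE ?mule_ge0// lee_fin.
Qed.

Section finite_exponential_moment.
Context (a : R) (a_gt0 : 0 < a).
Hypothesis a_fin : (\int[P]_w (expR (a * D w))%:E < +oo)%E.

Let integrable_exp_lt h : h <= a ->
  P.-integrable setT (fun w => (expR (h * D w))%:E).
Proof.
move=> ha; apply: (@le_integrable _ _ _ P _ _ _ (fun w => (expR (a * D w))%:E)) => //.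
- exact/measurable_EFinP.
- move=> w _; rewrite lee_fin !ger0_norm ?expR_ge0// ler_expR ler_wpM2r//.
- exact: integrable_exp.
Qed.

Let integrable_DexpR_lta h : h < a ->
  P.-integrable setT (fun w => (D w * expR (h * D w))%:E).
Proof.
move=> ha; apply: (@integrable_DexpR (a - h)); first by rewrite subr_gt0.
by rewrite addrC subrK; exact: integrable_exp_lt.
Qed.

Let integral_exp_gt0 h : -1 <= h -> (0 < \int[P]_w (expR (h * D w))%:E)%E.
Proof.
move=> h1; apply: (@lt_le_trans _ _ (\int[P]_w (expR (-1 * D w))%:E)%E).
  by rewrite integral_exp ?lerN10// lte_fin expR_gt0.
apply: ge0_le_integral => //.
- exact/measurable_EFinP.
- exact/measurable_EFinP.
- by move=> w _; rewrite lee_fin ler_expR ler_wpM2r.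
Qed.

(** For h >= 0 the moment of D is transferred to nu: in the identity on [0, +oo] the left side is
    finite below a, whereas an infinite integral against nu, multiplied by E exp(hD) > 0, would make
    the right side infinite. *)
Let nu_integrable_xexpR h : h < a ->
  nu.-integrable pos (fun x => (x * expR (h * x))%:E).
Proof.
move=> ha; have [h0|h0] := ltP h 0; first exact: levy_measure_integrable_xexpR.
have h1 : -1 <= h by rewrite (le_trans _ h0)// lerN10.
have x0 (x : R) : pos x -> 0 <= x * expR (h * x).
  by rewrite /= in_itv/= andbT => /ltW x0; rewrite mulr_ge0 ?expR_ge0.
apply/integrableP; split.
  by apply/measurable_EFinP; apply: measurable_funM => //; exact: nu_mexp.
under eq_integral => x /set_mem xp.
  rewrite gee0_abs; last by rewrite lee_fin x0.
  over.
have := integral_DexpR h1.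
have /(integrable_fin_num measurableT) := integrable_DexpR_lta ha.
case: (\int[P]_w (D w * expR (h * D w))%:E)%E => // r _.
have C_gt0 := integral_exp_gt0 h1.
have J_ge0 : (0 <= \int[nu]_(x in pos) (x * expR (h * x))%:E)%E.
  by apply: integral_ge0 => x xp; rewrite lee_fin x0.
rewrite ltey; apply: contra_eqN => /eqP ->.
have bC_ge0 : (0 <= b%:E * \int[P]_w (expR (h * D w))%:E)%E.
  by rewrite mule_ge0 ?lee_fin// ltW.
rewrite gt0_mulye// addey; last by rewrite gt_eqF// (lt_le_trans _ bC_ge0).
by rewrite gt0_muley.
Qed.

Let nu_integrable_expRB1 h : h < a ->
  nu.-integrable pos (fun x => (expR (h * x) - 1)%:E).
Proof.
move=> ha; have [h0|h0] := leP h 0; first exact: levy_measure_integrable_expRB1.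
apply: (@le_integrable _ _ _ nu _ _ _ (fun x => (h%:E * (x * expR (h * x))%:E)%E)) => //.
- by apply/measurable_EFinP; apply: measurable_funB => //; exact: nu_mexp.
- move=> x; rewrite /= in_itv/= andbT => /ltW x0; rewrite lee_fin.
  rewrite !ger0_norm ?expRB1_le//; first by rewrite !mulr_ge0 ?expR_ge0 ?(ltW h0).
  by rewrite subr_ge0 -[leLHS]expR0 ler_expR mulr_ge0 ?(ltW h0).
- by apply: integrableZl => //; exact: nu_integrable_xexpR.
Qed.

Let integral_exp_lt h : 0 <= h -> h < a ->
  (\int[P]_w (expR (h * D w))%:E = (expR (t * exponent h))%:E)%E.
Proof.
move=> h0 ha.
pose psi l := \int[P]_w (expR (l * D w) - 1).
(* E exp(lD) multiplied by the inverse of its claimed value. By [integral_DexpR] its derivative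
   vanishes on ]-1, a[, and at 0 the value is 1. *)
pose K l := (1 + psi l) * expR (- t * exponent l).
have psiE l : l <= a -> (\int[P]_w (expR (l * D w))%:E = (1 + psi l)%:E)%E.
  by move=> la; rewrite integral_expE//; exact: integrable_exp_lt.
have dK l : -1 < l -> l < a -> is_derive l 1 K 0.
  move=> l1 la.
  have D1 : is_derive l 1 psi _ := is_derive_integral_expRB1 measurableT mD (fun w _ => D_ge0 w)
    (fun l' (l0 : l' < a) => integrable_expRB1 (integrable_exp_lt (ltW l0)))
    integrable_DexpR_lta la.
  have D2 := is_derive_exponent nu_integrable_expRB1 nu_integrable_xexpR la.
  have := integral_DexpR (ltW l1).
  rewrite psiE ?ltW// -[X in (X = _)%E]fineK; last first.
    by apply: integrable_fin_num => //; exact: integrable_DexpR_lta.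
  rewrite -[X in (_ + X * _)%E]fineK; last first.
    by apply: integrable_fin_num => //; exact: nu_integrable_xexpR.
  rewrite -!EFinM => -[E].
  have -> : K = (fun l => 1 + psi l) \* (expR \o (fun l => - t * exponent l)) by [].
  apply: is_derive_eq.
  rewrite add0r /GRing.scale/= {1}/Rintegral E /exponent_derive /Rintegral; ring.
have K0 : K h = K 0.
  have dK' x : x \in `]0, h[ -> is_derive x 1 K 0.
    by rewrite in_itv/= => /andP[x0 xh]; apply: dK; lra.
  have [|c _ /eqP] := MVT_segment h0 dK'.
    apply: derivable_within_continuous => x; rewrite in_itv/= => /andP[x0 xh].
    by have [] : is_derive x 1 K 0 by apply: dK; lra.
  by rewrite mul0r subr_eq0 => /eqP.
have e0 : 1 + psi 0 = expR (t * exponent 0).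
  by apply: EFin_inj; rewrite -(psiE _ (ltW a_gt0)) (integral_exp (lexx 0)).
have K1 : K 0 = 1.
  rewrite /K e0 mulNr expRN; apply: divff; apply: lt0r_neq0; exact: expR_gt0.
rewrite (psiE _ (ltW ha)); congr EFin; move: K0; rewrite K1 /K mulNr expRN.
by move/(canRL (mulfVK (lt0r_neq0 (expR_gt0 _)))); rewrite mul1r.
Qed.

(** At the endpoint a itself D exp(aD) may fail to be integrable, so the differential equation is
    available only below a. The formula is taken along h n increasing to a, with monotone
    convergence under P and under nu. *)
Lemma laplace_bernstein_neg :
  (\int[P]_w (expR (a * D w))%:E = (expR (- t * bernstein b nu (- a)))%:E)%E.
Proof.
pose h n : R := a * (1 - n.+1%:R^-1).
have h_ge0 n : 0 <= h n.
  by rewrite mulr_ge0 ?(ltW a_gt0)// subr_ge0 invf_le1// ler1n.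
have h_lt n : h n < a.
  by rewrite -[ltRHS]mulr1 ltr_pM2l// ltrBlDr ltrDl invr_gt0.
have h_nd : nondecreasing_seq h.
  move=> m n mn; rewrite ler_wpM2l ?(ltW a_gt0)// lerB// lef_pV2 ?posrE//.
  by rewrite ler_nat.
have h_cvg : h @ \oo --> a.
  rewrite -[X in _ --> X]mulr1; apply: cvgMr.
  rewrite -[X in _ --> X]subr0; apply: cvgB; first exact: cvg_cst.
  exact: cvg_harmonic.
have e_cvg x : (fun n => expR (h n * x)) @ \oo --> expR (a * x).
  apply: (@cvg_comp _ _ _ (fun n => h n * x) expR _ (nbhs (a * x))).
    exact: cvgMl.
  exact: continuous_expR.
pose C := fine (\int[P]_w (expR (a * D w))%:E).
have CE : (\int[P]_w (expR (a * D w))%:E)%E = C%:E.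
  by rewrite fineK//; apply: integrable_fin_num => //; exact: integrable_exp_lt.
have C_gt0 : 0 < C.
  by rewrite -lte_fin -CE integral_exp_gt0// (le_trans _ (ltW a_gt0))// lerN10.
have cC : (fun n => expR (t * exponent (h n))) @ \oo --> C.
  apply: (@fine_cvg _ _ _ _ (fun n => (expR (t * exponent (h n)))%:E)).
  under eq_fun do rewrite -integral_exp_lt//.
  rewrite -CE (_ : (\int[P]_w (expR (a * D w))%:E)%E =
     (\int[P]_w limn (fun n => (expR (h n * D w))%:E))%E).
    apply: cvg_monotone_convergence => //.
    - by move=> n; exact/measurable_EFinP.
    - by move=> w _ m n mn; rewrite lee_fin ler_expR ler_wpM2r// h_nd.
  apply: eq_integral => w _; apply/esym/cvg_lim => //.
  by apply: cvg_EFin; [exact: nearW|exact: e_cvg].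
(* Solving exp(t exponent(h n)) --> C for the integral against nu gives a finite limit. It must
   coincide with the monotone limit below, which proves integrability at a instead of assuming
   it. *)
have cI : (fun n => \int[nu]_(x in pos) (expR (h n * x) - 1)) @ \oo -->
    ln C / t - b * a.
  have -> : (fun n => \int[nu]_(x in pos) (expR (h n * x) - 1)) =
      (fun n => ln (expR (t * exponent (h n))) / t - b * h n).
    apply/funext => n; rewrite expRK mulrAC divff ?gt_eqF// mul1r /exponent.
    by rewrite addrAC subrr add0r.
  apply: cvgB; last exact: cvgMr.
  apply: cvgMl; have lnC := continuous_ln C_gt0. exact: (cvg_comp _ _ cC lnC).
have cI' : (\int[nu]_(x in pos) (expR (h n * x) - 1)%:E)%E @[n --> \oo] -->
    (\int[nu]_(x in pos) (expR (a * x) - 1)%:E)%E.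
  rewrite (_ : (\int[nu]_(x in pos) (expR (a * x) - 1)%:E)%E =
     (\int[nu]_(x in pos) limn (fun n => (expR (h n * x) - 1)%:E))%E).
    apply: cvg_monotone_convergence => //.
    - by move=> n; apply/measurable_EFinP; apply: measurable_funB => //; exact: nu_mexp.
    - move=> n x; rewrite /= in_itv/= andbT => /ltW x0.
      by rewrite lee_fin subr_ge0 -[leLHS]expR0 ler_expR mulr_ge0.
    - move=> x; rewrite /= in_itv/= andbT => /ltW x0 m n mn.
      by rewrite lee_fin lerB// ler_expR ler_wpM2r// h_nd.
  apply: eq_integral => x _; apply/esym/cvg_lim => //.
  apply: cvg_EFin; first exact: nearW.
  by apply: cvgB; [exact: e_cvg|exact: cvg_cst].
have IE : (\int[nu]_(x in pos) (expR (a * x) - 1)%:E)%E = (ln C / t - b * a)%:E.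
  rewrite -(cvg_lim _ cI')//; apply/cvg_lim => //.
  have -> : (fun n => \int[nu]_(x in pos) (expR (h n * x) - 1)%:E)%E =
      (fun n => (\int[nu]_(x in pos) (expR (h n * x) - 1))%:E).
    apply/funext => n; rewrite fineK//; apply: integrable_fin_num => //.
    exact: nu_integrable_expRB1.
  by apply: cvg_EFin; first exact: nearW.
rewrite CE bernsteinE opprK; last first.
  apply/integrableP; split.
    by apply/measurable_EFinP; apply: measurable_funB => //; exact: nu_mexp.
  under eq_integral => x /set_mem xp.
    rewrite gee0_abs; last first.
      move: xp; rewrite /= in_itv/= andbT => /ltW x0.
      by rewrite lee_fin subr_ge0 -[leLHS]expR0 ler_expR mulr_ge0 ?(ltW a_gt0).
    over.
  by rewrite IE ltry.
rewrite mulrNN /exponent /Rintegral IE /= addrC subrK mulrC divfK ?gt_eqF//.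
by rewrite lnK.
Qed.

End finite_exponential_moment.
End bernstein_extension.

(** * Expectations under independence *)

Section weighted_pushforward.
Local Open Scope ereal_scope.
Context d (T : measurableType d) (R : realType) (mu : {measure set T -> \bar R}).
Context d' (U : measurableType d') (kappa : {measure set U -> \bar R}).
Context (Y : T -> U) (W : T -> R).
Hypothesis mY : measurable_fun setT Y.
Hypothesis mW : measurable_fun setT W.
Hypothesis W_ge0 : forall w, (0 <= W w)%R.
Hypothesis kappaE : forall B, measurable B ->
  kappa B = \int[mu]_(w in Y @^-1` B) (W w)%:E.

Import HBNNSimple.

Let mYB B : measurable B -> measurable (Y @^-1` B).
Proof. by move=> mB; rewrite -[X in measurable X]setTI; exact: mY. Qed.

Let integral_weighted_nnsfun (h : {nnsfun U >-> R}) :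
  \int[kappa]_x (h x)%:E = \int[mu]_w ((W w)%:E * (h (Y w))%:E).
Proof.
have mr (r : R) : measurable (h @^-1` [set r]) by exact: measurable_funPTI.
have m1 (r : R) : measurable_fun setT (fun w => (r * \1_(h @^-1` [set r]) (Y w))%:E).
  apply/measurable_EFinP/measurable_funM => //.
  exact: measurableT_comp.
have p1 (r : R) x : 0 <= (r * \1_(h @^-1` [set r]) x)%:E.
  by rewrite EFinM nnfun_muleindic_ge0.
transitivity (\sum_(r \in range h)
    \int[mu]_w ((W w)%:E * (r * \1_(h @^-1` [set r]) (Y w))%:E)); last first.
  rewrite -ge0_integral_fsum//; last 2 first.
  - by move=> r; apply: emeasurable_funM => //; exact/measurable_EFinP.
  - by move=> r w _; apply: mule_ge0; [rewrite lee_fin|exact: p1].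
  by apply: eq_integral => w _; rewrite fimfunE -fsumEFin// ge0_mule_fsumr.
transitivity (\sum_(r \in range h) \int[kappa]_x (r * \1_(h @^-1` [set r]) x)%:E).
  rewrite -ge0_integral_fsum//; last first.
    by move=> r; exact/measurable_EFinP/measurable_funM.
  by apply: eq_integral => x _; rewrite fimfunE -fsumEFin.
apply: eq_fsbigr => r _; have [r0|r0] := ltP r 0%R.
  have z x : (r * \1_(h @^-1` [set r]) x)%:E = 0.
    by rewrite preimage_nnfun0// indic0 mulr0.
  by rewrite !integral0_eq// => w _; rewrite z ?mule0.
rewrite integralZl_indic_nnsfun// integral_indic// setIT kappaE//.
rewrite [in LHS]integral_mkcond -ge0_integralZl//; last 2 first.
- apply/(measurable_restrictT (fun w => (W w)%:E) (mYB (mr r))).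
  by apply: measurable_funTS; exact/measurable_EFinP.
- by move=> w _; apply: erestrict_ge0 => ? _; rewrite lee_fin.
apply: eq_integral => w _; rewrite EFinM muleCA; congr (_ * _).
rewrite patchE indicE; case: ifPn => [/set_mem Yw|Yw].
  by rewrite mem_set// mule1.
by rewrite memNset ?mule0// => Yw'; move/negP : Yw; apply; rewrite inE.
Qed.

(** Change of variables for the image under Y of the measure with density W, by simple functions and
    monotone convergence. It serves both for independent weights and, with Y the identity, for a law
    given by a density. *)
Lemma ge0_integral_weighted_pushforward (phi : U -> \bar R) :
  measurable_fun setT phi -> (forall x, 0 <= phi x) ->
  \int[kappa]_x phi x = \int[mu]_w ((W w)%:E * phi (Y w)).
Proof.
move=> mphi phi0; pose h := nnsfun_approx measurableT mphi.
have h_nd x : nondecreasing_seq (fun n => (h n x)%:E).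
  by move=> m n mn; rewrite lee_fin; exact/lefP/nd_nnsfun_approx.
have h_cvg x : (h n x)%:E @[n --> \oo] --> phi x.
  exact: cvg_nnsfun_approx.
have c1 : \int[mu]_w ((W w)%:E * (h n (Y w))%:E) @[n --> \oo] -->
    \int[mu]_w ((W w)%:E * phi (Y w)).
  rewrite (_ : \int[mu]_w ((W w)%:E * phi (Y w)) =
      \int[mu]_w limn (fun n => (W w)%:E * (h n (Y w))%:E)).
    apply: cvg_monotone_convergence => //.
    - move=> n; apply: emeasurable_funM => //; first exact/measurable_EFinP.
      by apply/measurable_EFinP; exact: measurableT_comp.
    - by move=> n w _; rewrite mule_ge0 ?lee_fin.
    - by move=> w _ m n mn; rewrite lee_wpmul2l ?lee_fin//; exact: h_nd.
  by apply: eq_integral => w _; apply/esym/cvg_lim => //; exact: cvgeZl.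
have c2 : \int[kappa]_x (h n x)%:E @[n --> \oo] --> \int[kappa]_x phi x.
  rewrite (_ : \int[kappa]_x phi x = \int[kappa]_x limn (fun n => (h n x)%:E)).
    apply: cvg_monotone_convergence => //.
      by move=> n; exact/measurable_EFinP.
    by move=> n w _; rewrite lee_fin.
  by apply: eq_integral => w _; apply/esym/cvg_lim => //; exact: h_cvg.
rewrite -(cvg_lim _ c2)// -(cvg_lim _ c1)//.
by under eq_fun do rewrite integral_weighted_nnsfun.
Qed.

End weighted_pushforward.

Section independent_weight.
Local Open Scope ereal_scope.
Context d (T : measurableType d) (R : realType) (P : probability T R).
Context d' (U : measurableType d') (Y : T -> U) (W : T -> R).
Hypothesis mY : measurable_fun setT Y.
Hypothesis mW : measurable_fun setT W.
Hypothesis W_ge0 : forall w, (0 <= W w)%R.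
Hypothesis WY : forall B, measurable B ->
  \int[P]_(w in Y @^-1` B) (W w)%:E = \int[P]_w (W w)%:E * P (Y @^-1` B).
Hypothesis W_fin : \int[P]_w (W w)%:E \is a fin_num.

(** By [WY], the image under Y of the measure with density W is the law of Y scaled by E[W]. *)
Lemma integral_indep_weight (phi : U -> \bar R) :
  measurable_fun setT phi -> (forall x, 0 <= phi x) ->
  \int[P]_w ((W w)%:E * phi (Y w)) = \int[P]_w (W w)%:E * \int[P]_w phi (Y w).
Proof.
move=> mphi phi0.
have c_ge0 : (0 <= fine (\int[P]_w (W w)%:E))%R.
  by rewrite fine_ge0// integral_ge0// => w _; rewrite lee_fin.
pose Ymix := isMeasurableFun.Build _ _ _ _ _ mY.
pose Y' : {mfun T >-> U} := HB.pack Y Ymix.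
pose kappa := mscale (NngNum c_ge0) (distribution P Y').
rewrite -(@ge0_integral_weighted_pushforward _ T R P _ U kappa)//; last first.
  by move=> B mB; rewrite WY// -[X in X * _]fineK.
by rewrite ge0_integral_mscale//= fineK// ge0_integral_distribution.
Qed.

End independent_weight.

Section independence_expectations.
Local Open Scope ereal_scope.
Context d (T : measurableType d) (R : realType) (P : probability T R).

Lemma integral_indep_event d' (U : measurableType d') (A : set T) (Y : T -> U)
    (phi : U -> \bar R) :
  measurable A -> measurable_fun setT Y ->
  (forall B, measurable B -> P (A `&` Y @^-1` B) = P A * P (Y @^-1` B)) ->
  measurable_fun setT phi -> (forall x, 0 <= phi x) ->
  \int[P]_(w in A) phi (Y w) = P A * \int[P]_w phi (Y w).
Proof.
move=> mA mY AY mphi phi0.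
have mYB B : measurable B -> measurable (Y @^-1` B).
  by move=> mB; rewrite -[X in measurable X]setTI; exact: mY.
have intA : \int[P]_w (\1_A w : R)%:E = P A by rewrite integral_indic// setIT.
have := @integral_indep_weight _ T R P _ U Y \1_A mY (measurable_indic mA).
rewrite intA => <- //.
- rewrite integral_mkcond; apply: eq_integral => w _.
  by rewrite patchE indicE; case: ifPn => _; rewrite ?mul1e ?mul0e.
- by move=> B mB; rewrite integral_indic//; [exact: AY|exact: mYB].
- by rewrite fin_num_measure.
Qed.

Lemma expectation_prod_indep (Xs : nat -> {RV P >-> R}) (phi : R -> R) n :
  mutually_independent P Xs ->
  measurable_fun setT phi -> (forall x, (0 <= phi x)%R) ->
  (forall i, \int[P]_w (phi (Xs i w))%:E \is a fin_num) ->
  \int[P]_w (\prod_(i < n) phi (Xs i w))%:E =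
  \prod_(i < n) \int[P]_w (phi (Xs i w))%:E.
Proof.
move=> Xind mphi phi0 phi_fin.
have mX i B : measurable B -> measurable (Xs i @^-1` B).
  by move=> mB; rewrite -[X in measurable X]setTI; exact: measurable_funP.
have mprod m : measurable_fun setT (fun w => (\prod_(i < m) phi (Xs i w))%R).
  apply: measurable_prod => i _; exact: measurableT_comp.
have mtail s B : (forall i, measurable (B i)) ->
    measurable (\bigcap_(i in [set` s]) Xs i @^-1` B i).
  move=> mB; apply: bigcap_measurableType => // i _; exact: mX.
(* Independence is given for events only and is turned into a statement about functions one index at
   a time: phi on the indices below m, events on the k indices from m on. With k universally
   quantified, the case k + 1 at m supplies the independence from Xs m required by the step to m +
   1. *)
suff H m : forall k B, (forall i, measurable (B i)) ->
    \int[P]_(w in \bigcap_(i in [set` iota m k]) Xs i @^-1` B i)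
      (\prod_(i < m) phi (Xs i w))%:E =
    (\prod_(i < m) \int[P]_w (phi (Xs i w))%:E) *
    \prod_(i <- iota m k) P (Xs i @^-1` B i).
  have := H n 0%N (fun=> setT) (fun=> measurableT).
  by rewrite big_nil mule1 /= set_nil bigcap_set0.
elim: m => [|m IH] k B mB.
  rewrite big_ord0 mul1e -Xind ?iota_uniq//.
  under eq_integral do rewrite big_ord0.
  by rewrite integral_cst ?mul1e//; exact: mtail.
set E := \bigcap_(i in _) _.
pose W w := (\prod_(i < m) phi (Xs i w) * \1_E w)%R.
have mE : measurable E by exact: mtail.
have intW C : measurable C -> \int[P]_(w in Xs m @^-1` C) (W w)%:E =
    (\prod_(i < m) \int[P]_w (phi (Xs i w))%:E) *
    \prod_(i <- iota m.+1 k) P (Xs i @^-1` B i) * P (Xs m @^-1` C).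
  move=> mC; pose B' i := if i == m then C else B i.
  have B'm : B' m = C by rewrite /B' eqxx.
  have mB' i : measurable (B' i) by rewrite /B'; case: ifPn.
  have := IH k.+1 B' mB'; rewrite /= big_cons B'm.
  have -> : \prod_(j <- iota m.+1 k) P (Xs j @^-1` B' j) =
      \prod_(j <- iota m.+1 k) P (Xs j @^-1` B j).
    apply: eq_big_seq => j; rewrite mem_iota /B' => /andP[mj _].
    by rewrite gtn_eqF.
  rewrite muleCA [RHS]muleC => <-.
  have -> : \bigcap_(i in [set` m :: iota m.+1 k]) Xs i @^-1` B' i =
      Xs m @^-1` C `&` E.
    apply/seteqP; split=> w /=.
      move=> H; split; first by have := H m (mem_head _ _); rewrite /B' eqxx.
      move=> j /= jm; have := H j; rewrite /= inE jm orbT => /(_ isT).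
      by move: jm; rewrite mem_iota /B' => /andP[mj _]; rewrite gtn_eqF.
    move=> [Cw Ew] j; rewrite /= inE => /predU1P[->|jm]; first by rewrite /B' eqxx.
    rewrite /B'; move: (jm); rewrite mem_iota => /andP[mj _]; rewrite gtn_eqF//.
    exact: Ew.
  rewrite integral_mkcondr; apply: eq_integral => w _.
  by rewrite patchE /W indicE; case: ifPn => _; rewrite ?mulr1 ?mulr0.
have intWT : \int[P]_w (W w)%:E = (\prod_(i < m) \int[P]_w (phi (Xs i w))%:E) *
    \prod_(i <- iota m.+1 k) P (Xs i @^-1` B i).
  by have := intW _ measurableT; rewrite preimage_setT probability_setT mule1.
have W_ge0 w : (0 <= W w)%R.
  by rewrite mulr_ge0 ?prodr_ge0// => i _.
have mW : measurable_fun setT W by apply: measurable_funM => //; exact: measurable_indic.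
have prodfin (I : Type) (r : seq I) (F : I -> \bar R) :
    (forall i, F i \is a fin_num) -> \prod_(i <- r) F i \is a fin_num.
  by move=> Ffin; apply: (big_ind (fun x => x \is a fin_num)) => // x y; exact: fin_numM.
have W_fin : \int[P]_w (W w)%:E \is a fin_num.
  rewrite intWT fin_numM//; first exact: prodfin.
  by apply: prodfin => i; apply: fin_num_measure; exact: mX.
have mphiE : measurable_fun setT (EFin \o phi) by exact/measurable_EFinP.
have WX B' : measurable B' -> \int[P]_(w in Xs m @^-1` B') (W w)%:E =
    \int[P]_w (W w)%:E * P (Xs m @^-1` B').
  by move=> mB'; rewrite intW// intWT.
have := integral_indep_weight (measurable_funP (Xs m)) mW W_ge0 WX W_fin mphiE.
rewrite [X in _ -> _ = X * _]big_ord_recr/= muleAC -intWT => <-; last first.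
  by move=> x; rewrite /= lee_fin.
rewrite [LHS]integral_mkcond; apply: eq_integral => w _.
rewrite patchE /W indicE big_ord_recr/= -EFinM.
by case: ifPn => _; rewrite ?mulr1// mulr0 mul0r.
Qed.

End independence_expectations.

(** * A Poisson process at an independent random time *)

Section dyadic.
Context {R : realType}.
Implicit Types x : R.

(** The successor makes the value strictly larger than x even when x is dyadic: the right limit of a
    path ignores the point itself, and the Poisson law is available only at positive times. *)
Definition dyadic_up m x : R := (Num.truncn (2 ^+ m * x)).+1%:R / 2 ^+ m.

Lemma dyadic_up_gt m x : 0 <= x -> x < dyadic_up m x.
Proof.
move=> x0; have m0 : (0 : R) < 2 ^+ m by rewrite exprn_gt0.
by rewrite ltr_pdivlMr// mulrC truncnS_gt.
Qed.

Lemma dyadic_up_le m x : 0 <= x -> dyadic_up m x <= x + 2 ^- m.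
Proof.
move=> x0; have m0 : (0 : R) < 2 ^+ m by rewrite exprn_gt0.
rewrite ler_pdivrMr// mulrDl mulVf ?gt_eqF// -natr1 lerD2r (mulrC x).
have : 0 <= 2 ^+ m * x by rewrite mulr_ge0 ?(ltW m0).
by move=> /truncn_itv/andP[].
Qed.

Lemma dyadic_up_cvg x : 0 <= x -> dyadic_up ^~ x @ \oo --> x.
Proof.
move=> x0; apply: (@squeeze_cvgr _ _ _ _ (cst x) (fun m => x + 2 ^- m)).
- by apply: nearW => m; rewrite dyadic_up_le// andbT ltW// dyadic_up_gt.
- exact: cvg_cst.
- rewrite -[X in _ --> X]addr0; apply: cvgD; first exact: cvg_cst.
  have -> : (fun m => 2 ^- m) = geometric 1 (2^-1 : R).
    by apply/funext => m; rewrite /= exprVn mul1r.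
  by apply: cvg_geometric; rewrite ger0_norm// invf_lt1// ltr1n.
Qed.

Definition dyadic_itv m j : set R := `[j%:R / 2 ^+ m, j.+1%:R / 2 ^+ m[%classic.

Lemma measurable_dyadic_itv m j : measurable (dyadic_itv m j).
Proof. exact: measurable_itv. Qed.

Lemma dyadic_itvP m j x : 0 <= x ->
  dyadic_itv m j x <-> Num.truncn (2 ^+ m * x) = j.
Proof.
move=> x0; have m0 : (0 : R) < 2 ^+ m by rewrite exprn_gt0.
have p0 : 0 <= 2 ^+ m * x by rewrite mulr_ge0 ?(ltW m0).
rewrite /dyadic_itv /= in_itv/= ler_pdivrMr// ltr_pdivlMr// (mulrC x).
by split=> [/truncn_def//|<-]; exact: truncn_itv.
Qed.

End dyadic.

Section poisson_at_random_time.
Context d (T : measurableType d) (R : realType) (P : probability T R).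
Context (N : R -> {RV P >-> nat}) (D : T -> R) (lambda : R).
Hypothesis N_right_continuous : right_continuous_paths (fun t w => (N t w)%:R : R).
Hypothesis mD : measurable_fun setT D.
Hypothesis D_ge0 : forall w, 0 <= D w.

Let Z m w := N (dyadic_up m (D w)) w.

Let Z_cvg w : \forall m \near \oo, Z m w = N (D w) w.
Proof.
have rc : (N s w)%:R @[s --> (D w)^'+] --> ((N (D w) w)%:R : R).
  exact: N_right_continuous.
have /cvg_at_rightP/(_ (dyadic_up ^~ (D w))) := rc.
move=> /(_ (conj (fun m => dyadic_up_gt m (D_ge0 w)) (dyadic_up_cvg (D_ge0 w)))).
(* Natural numbers at distance less than 1 are equal, so convergence of the values means that they
   are eventually constant. *)
move/cvgrPdist_lt => /(_ 1 ltr01); apply: filterS => m; rewrite -/(Z m w).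
rewrite ltr_norml => /andP[h1 h2].
have h1' : (Z m w < (N (D w) w).+1)%N by rewrite -(ltr_nat R) -natr1; lra.
have h2' : (N (D w) w < (Z m w).+1)%N by rewrite -(ltr_nat R) -natr1; lra.
by apply/eqP; rewrite eqn_leq -ltnS h1' -ltnS h2'.
Qed.

Let cellE m n : [set w | Z m w = n] =
  \bigcup_j (N (j.+1%:R / 2 ^+ m) @^-1` [set n] `&` D @^-1` dyadic_itv m j).
Proof.
apply/seteqP; split=> w /=.
  move=> Zn; exists (Num.truncn (2 ^+ m * D w)) => //=; split; first by [].
  exact/dyadic_itvP.
by move=> [j _ [/= Nn /(dyadic_itvP _ _ (D_ge0 w)) Dj]]; rewrite /Z /dyadic_up Dj.
Qed.

Let mNset s n : measurable (N s @^-1` [set n]).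
Proof. by rewrite -[X in measurable X]setTI; exact: measurable_funP. Qed.

Let mDset B : measurable B -> measurable (D @^-1` B).
Proof. by move=> mB; rewrite -[X in measurable X]setTI; exact: mD. Qed.

Let mcell m n : measurable [set w | Z m w = n].
Proof.
rewrite cellE; apply: bigcup_measurable => j _; apply: measurableI => //.
by apply: mDset; exact: measurable_dyadic_itv.
Qed.

Let limitE n : [set w | N (D w) w = n] =
  \bigcup_M \bigcap_(m in [set m | (M <= m)%N]) [set w | Z m w = n].
Proof.
apply/seteqP; split=> w /=.
  by move=> <-; have [M _ MZ] := Z_cvg w; exists M => // m /= Mm; exact: MZ.
move=> [M _ MZ]; have [M' _ MZ'] := Z_cvg w.
rewrite -(MZ' (maxn M M')) ?MZ//=; first exact: leq_maxl.
exact: leq_maxr.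
Qed.

Let mlimit n : measurable [set w | N (D w) w = n].
Proof.
rewrite limitE; apply: bigcup_measurable => M _.
by apply: bigcap_measurableType => m _; exact: mcell.
Qed.

(** Right-continuity stands in for joint measurability in (t, w): N(D) is the eventual value of
    [Z m], and on each of the countably many dyadic cells of D, [Z m] is N at a deterministic
    time. *)
Lemma measurable_random_time : measurable_fun setT (fun w => N (D w) w).
Proof.
move=> _ B _; rewrite setTI.
rewrite (_ : _ @^-1` B = \bigcup_(n in B) [set w | N (D w) w = n]).
  by apply: bigcup_measurable => n _; exact: mlimit.
apply/seteqP; split=> [w Bw|w [n Bn /= Nw]]; first by exists (N (D w) w).
by rewrite /= Nw.
Qed.

(** Equal to [poisson_pmf] of lambda x when this is positive. At x = 0 it gives the Dirac mass
    instead, so it is continuous there, as needed since D may vanish. *)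
Definition poisson_weight n x : R := (lambda * x) ^+ n / n`!%:R * expR (- (lambda * x)).

Hypothesis lambda_gt0 : 0 < lambda.
Hypothesis N_law : forall s n, 0 < s ->
  P [set w | N s w = n] = (poisson_weight n s)%:E.
Hypothesis N_D_indep : forall s n B, 0 <= s -> measurable B ->
  (P ([set w | N s w = n] `&` D @^-1` B) = P [set w | N s w = n] * P (D @^-1` B))%E.

Let weight_ge0 n x : 0 <= x -> 0 <= poisson_weight n x.
Proof.
by move=> x0; rewrite mulr_ge0 ?expR_ge0// divr_ge0// exprn_ge0// mulr_ge0// ltW.
Qed.

Let continuous_weight n : continuous (poisson_weight n).
Proof.
move=> x; rewrite /poisson_weight.
apply: cvgM; first apply: cvgMl.
  apply: (@cvg_comp _ _ _ (fun x => lambda * x) (fun y => y ^+ n) _ (nbhs (lambda * x))).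
    exact: mulrl_continuous.
  exact: exprn_continuous.
apply: (@cvg_comp _ _ _ (fun x => - (lambda * x)) expR _ (nbhs (- (lambda * x)))).
  by apply: cvgN; exact: mulrl_continuous.
exact: continuous_expR.
Qed.

Let mweight n : measurable_fun setT (fun w => poisson_weight n (D w)).
Proof.
apply: measurableT_comp => //; apply: continuous_measurable_fun.
exact: continuous_weight.
Qed.

Let dyadic_cells m : \bigcup_j (D @^-1` dyadic_itv m j) = setT.
Proof.
apply/seteqP; split=> w // _; exists (Num.truncn (2 ^+ m * D w)) => //=.
exact/dyadic_itvP.
Qed.

Let trivIset_cells m : trivIset setT (fun j => D @^-1` dyadic_itv m j).
Proof.
apply/trivIsetP => i j _ _ /eqP ij; apply/seteqP; split=> w //= [].
move=> /(dyadic_itvP _ _ (D_ge0 w)) hi /(dyadic_itvP _ _ (D_ge0 w)) hj.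
by apply: ij; rewrite -hi.
Qed.

Let mcells m j : measurable (D @^-1` dyadic_itv m j).
Proof. by apply: mDset; exact: measurable_dyadic_itv. Qed.

Let mweight_up m n : measurable_fun setT (fun w => poisson_weight n (dyadic_up m (D w))).
Proof.
have mup : measurable_fun setT (dyadic_up m : R -> R).
  apply: nondecreasing_measurable => // x y xy.
  rewrite /dyadic_up ler_wpM2r ?invr_ge0 ?exprn_ge0// ler_nat ltnS.
  by apply: le_truncn; rewrite ler_wpM2l// exprn_ge0.
apply: (@measurableT_comp _ _ _ _ _ _ (poisson_weight n) _ (dyadic_up m \o D)).
  by apply: continuous_measurable_fun; exact: continuous_weight.
exact: measurableT_comp.
Qed.

Let weight_le1 n x : 0 <= x -> poisson_weight n x <= 1.
Proof.
move=> x0; have y0 : 0 <= lambda * x by rewrite mulr_ge0// ltW.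
rewrite /poisson_weight expRN ler_pdivrMr ?expR_gt0// mul1r.
apply: le_trans (series_exp_coeff_le n.+1 y0).
rewrite /series/= big_nat_recr//= lerDr sumr_ge0// => i _.
exact: exp_coeff_ge0.
Qed.

Let cell_law m n : P [set w | Z m w = n] =
  (\int[P]_w (poisson_weight n (dyadic_up m (D w)))%:E)%E.
Proof.
have up_gt0 j : (0 : R) < j.+1%:R / 2 ^+ m by rewrite divr_gt0// exprn_gt0.
rewrite cellE measure_bigcup//; last 2 first.
- by move=> j _; apply: measurableI.
- by apply: trivIset_setIl; exact: trivIset_cells.
rewrite -(dyadic_cells m) ge0_integral_bigcup//; last 2 first.
- apply: measurable_funTS; exact/measurable_EFinP.
- by move=> w _; rewrite lee_fin weight_ge0// ltW// (le_lt_trans (D_ge0 w))// dyadic_up_gt.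
rewrite (eq_eseriesl (Q := xpredT)); last by move=> j; rewrite in_setT.
apply: eq_eseriesr => j _.
transitivity (P [set w | N (j.+1%:R / 2 ^+ m) w = n] * P (D @^-1` dyadic_itv m j))%E.
  by apply: N_D_indep; [exact: ltW|exact: measurable_dyadic_itv].
rewrite N_law//.
rewrite -integral_cst//; apply: eq_integral => w /set_mem /= /(dyadic_itvP _ _ (D_ge0 w)) Dj.
by rewrite /dyadic_up Dj.
Qed.

(** For the rounded time the formula is independence on each cell ([cell_law]). Both sides then pass
    to the limit by dominated convergence with bound 1: the indicators are eventually constant, and
    the weights are continuous. *)
Lemma random_time_law n :
  P [set w | N (D w) w = n] = (\int[P]_w (poisson_weight n (D w))%:E)%E.
Proof.
have int1 : P.-integrable setT (cst 1%E : T -> \bar R).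
  exact: finite_measure_integrable_cst.
have c1 : P [set w | Z m w = n] @[m --> \oo] --> P [set w | N (D w) w = n].
  have indicE' A : measurable A -> P A = (\int[P]_w (\1_A w)%:E)%E.
    by move=> mA; rewrite integral_indic// setIT.
  rewrite indicE'//; under eq_fun do rewrite indicE'//.
  apply: (@dominated_cvg _ _ _ P _ _ _ _ (cst 1%E)) => //.
  - by move=> m; apply/measurable_EFinP; exact: measurable_indic.
  - move=> w _; apply: cvg_near_cst; have := Z_cvg w; apply: filterS => m.
    rewrite !indicE => Zm; congr ((nat_of_bool _)%:R%:E).
    by apply/idP/idP => /set_mem/= h; apply/mem_set; rewrite /= -h.
  - by move=> m w _; rewrite lee_fin ger0_norm// indicE lern1 leq_b1.
have c2 : (\int[P]_w (poisson_weight n (dyadic_up m (D w)))%:E)%E @[m --> \oo] -->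
    (\int[P]_w (poisson_weight n (D w))%:E)%E.
  apply: (@dominated_cvg _ _ _ P _ _ _ _ (cst 1%E)) => //.
  - by move=> m; exact/measurable_EFinP.
  - move=> w _; apply: cvg_EFin; first exact: nearW.
    apply: (@cvg_comp _ _ _ (fun m => dyadic_up m (D w)) (poisson_weight n) _ (nbhs (D w))).
      exact: dyadic_up_cvg.
    exact: continuous_weight.
  - move=> m w _; have up0 : 0 <= dyadic_up m (D w).
      by rewrite ltW// (le_lt_trans (D_ge0 w))// dyadic_up_gt.
    by rewrite lee_fin ger0_norm ?weight_ge0// weight_le1.
rewrite -(cvg_lim _ c1)// -(cvg_lim _ c2)//.
by under eq_fun do rewrite cell_law.
Qed.

End poisson_at_random_time.

(** * Positivity of integrals and countable partitions *)

Section integration.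
Local Open Scope ereal_scope.
Context d (T : measurableType d) (R : realType) (mu : {measure set T -> \bar R}).

Lemma integral_gt0 (E : set T) (f : T -> R) :
  measurable E -> measurable_fun E f -> (forall x, E x -> (0 < f x)%R) ->
  mu E != 0 -> 0 < \int[mu]_(x in E) (f x)%:E.
Proof.
move=> mE mf f0; apply: contra_neqT => If.
have : \int[mu]_(x in E) `|(f x)%:E| = 0.
  under eq_integral => x /set_mem Ex.
    by rewrite gee0_abs ?lee_fin ?ltW ?f0//; over.
  apply/eqP; rewrite eq_le leNgt If/= integral_ge0// => x Ex.
  by rewrite lee_fin ltW ?f0.
have mfE : measurable_fun E (EFin \o f) by exact/measurable_EFinP.
move=> /(ae_eq_integral_abs mu mE mfE) [A [mA A0 EA]].
apply/eqP; rewrite -measure_le0 -A0 le_measure ?inE//.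
apply: subset_trans EA => x Ex /= /(_ Ex) /eqP.
by rewrite eqe gt_eqF// f0.
Qed.

Lemma ge0_integral_partition (K : T -> nat) (f : T -> \bar R) :
  (forall n, measurable [set w | K w = n]) ->
  measurable_fun setT f -> (forall w, 0 <= f w) ->
  \int[mu]_w f w = \sum_(n <oo) \int[mu]_(w in [set w | K w = n]) f w.
Proof.
move=> mK mf f0.
have KT : \bigcup_n [set w | K w = n] = setT.
  by apply/seteqP; split=> w // _; exists (K w).
rewrite -{1}KT ge0_integral_bigcup//; first by rewrite KT.
apply/trivIsetP => i j _ _ /eqP ij; apply/seteqP; split=> w //= [Ki Kj].
by apply: ij; rewrite -Ki.
Qed.

End integration.

(** * Generated sigma-algebras and exponential moments of i.i.d. sums *)

Section families.
Context d (T : measurableType d) (R : realType) (P : probability T R).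

Lemma sigma_of_family_preimage d' (U : measurableType d') (I : Type) (J : set I)
    (Z : I -> T -> U) i B :
  J i -> measurable B -> sigma_of_family J Z (Z i @^-1` B).
Proof.
move=> Ji mB; apply: sub_gen_smallest; exists i => //.
by exists B => //; rewrite setTI.
Qed.

(** Measurability of a finite sum, read on T equipped with the sigma-algebra that the family
    generates. *)
Lemma sigma_of_family_partial_sum (Xs : nat -> T -> R) n B : measurable B ->
  sigma_of_family [set: nat] Xs ((fun w => \sum_(i < n) Xs i w) @^-1` B).
Proof.
move=> mB; pose G := \bigcup_(i in [set: nat]) preimage_set_system setT (Xs i) measurable.
have mXs i : measurable_fun (setT : set (g_sigma_algebraType G)) (Xs i).
  by move=> _ C mC; rewrite setTI; exact: sigma_of_family_preimage.
have : measurable_fun (setT : set (g_sigma_algebraType G)) (fun w => \sum_(i < n) Xs i w).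
  by apply: measurable_sum => i.
by move=> /(_ measurableT _ mB); rewrite setTI.
Qed.

Lemma integral_iid (X Y : {RV P >-> R}) (phi : R -> R) :
  (forall A : set R, measurable A -> distribution P Y A = distribution P X A) ->
  measurable_fun setT phi -> (forall x, 0 <= phi x) ->
  (\int[P]_w (phi (Y w))%:E = \int[P]_w (phi (X w))%:E)%E.
Proof.
move=> XY mphi phi0.
have mphiE : measurable_fun setT (EFin \o phi) by exact/measurable_EFinP.
have phiE0 x : (0 <= (EFin \o phi) x)%E by rewrite lee_fin.
rewrite -(ge0_integral_distribution Y mphiE phiE0).
rewrite -(ge0_integral_distribution X mphiE phiE0).
by apply: eq_measure_integral => A mA _; exact: XY.
Qed.

Lemma expectation_exp_sum_iid (X : {RV P >-> R}) (Xs : nat -> {RV P >-> R}) u n :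
  iid_copies X Xs -> (\int[P]_w (expR (- u * X w))%:E)%E \is a fin_num ->
  (\int[P]_w (expR (- u * \sum_(i < n) Xs i w))%:E =
   (fine (\int[P]_w (expR (- u * X w))%:E) ^+ n)%:E)%E.
Proof.
move=> [Xind Xlaw] Mfin; pose phi x := expR (- u * x).
have mphi : measurable_fun setT phi by exact: measurableT_comp.
have phi0 x : 0 <= phi x by exact: expR_ge0.
have XsE i : (\int[P]_w (phi (Xs i w))%:E = \int[P]_w (phi (X w))%:E)%E.
  by apply: integral_iid => // A mA; exact: Xlaw.
transitivity (\int[P]_w (\prod_(i < n) phi (Xs i w))%:E)%E.
  by apply: eq_integral => w _; rewrite mulr_sumr expR_sum.
rewrite expectation_prod_indep//; last by move=> i; rewrite XsE.
under eq_bigr do rewrite XsE.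
by rewrite -[X in (\prod_(i < n) X)%E]fineK// prodEFin prodr_const card_ord.
Qed.

(* Truncating the exponential lets the product formula apply before
   its mean is known to be finite. *)
Lemma exp_moment_of_sum (X : {RV P >-> R}) (Xs : nat -> {RV P >-> R}) u n :
  iid_copies X Xs ->
  (\int[P]_w (expR (- u * \sum_(i < n.+1) Xs i w))%:E < +oo)%E ->
  (\int[P]_w (expR (- u * X w))%:E < +oo)%E.
Proof.
move=> [Xind Xlaw] Sfin.
pose phi K x := Num.min (expR (- u * x)) K%:R.
have mphi K : measurable_fun setT (phi K).
  by apply: measurable_minr => //; exact: measurableT_comp.
have phi0 K x : 0 <= phi K x by rewrite le_min expR_ge0/=.
have XsE K i : (\int[P]_w (phi K (Xs i w))%:E = \int[P]_w (phi K (X w))%:E)%E.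
  by apply: integral_iid => // A mA; exact: Xlaw.
have phifin K : (\int[P]_w (phi K (X w))%:E)%E \is a fin_num.
  rewrite ge0_fin_numE; last by apply: integral_ge0 => w _; rewrite lee_fin.
  apply: (@le_lt_trans _ _ (\int[P]_w cst (K%:R%:E : \bar R) w)%E).
    apply: ge0_le_integral => //.
    - by move=> w _; rewrite lee_fin.
    - by apply/measurable_EFinP; exact: measurableT_comp.
    - by move=> w _; rewrite lee_fin ge_min lexx orbT.
  rewrite integral_cst// -ge0_fin_numE; last by rewrite mule_ge0.
  by rewrite fin_numM// fin_num_measure.
set B := (\int[P]_w (expR (- u * \sum_(i < n.+1) Xs i w))%:E)%E in Sfin.
have Bfin : B \is a fin_num.
  by rewrite ge0_fin_numE//; apply: integral_ge0 => w _; rewrite lee_fin expR_ge0.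
(* The product formula gives m^(n+1) <= B for the truncated mean m. Either m <= 1, or m <= m^(n+1)
   <= B, so the bound does not depend on K. *)
have boundK K : (\int[P]_w (phi K (X w))%:E <= (Num.max 1 (fine B))%:E)%E.
  have : (\int[P]_w (\prod_(i < n.+1) phi K (Xs i w))%:E <= B)%E.
    apply: ge0_le_integral => //.
    - by move=> w _; rewrite lee_fin prodr_ge0.
    - apply/measurable_EFinP; apply: measurable_prod => i _; exact: measurableT_comp.
    - apply/measurable_EFinP; apply: measurableT_comp => //; apply: measurable_funM => //.
      exact: measurable_sum.
    - move=> w _; rewrite lee_fin mulr_sumr expR_sum; apply: ler_prod => i _.
      by rewrite phi0/= ge_min lexx.
  rewrite expectation_prod_indep//; last by move=> i; rewrite XsE.
  under eq_bigr do rewrite XsE.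
  rewrite -{1}[X in (\prod_(i < n.+1) X)%E]fineK// prodEFin prodr_const card_ord.
  rewrite -[X in (_ <= X)%E]fineK// -[X in (X <= (Num.max _ _)%:E)%E]fineK//.
  rewrite !lee_fin le_max; set m := fine _ => mB.
  have [//|m1] := leP m 1; apply/orP; right; apply: le_trans mB.
  by rewrite ler_eXnr// ltW.
apply: (@le_lt_trans _ _ (Num.max 1 (fine B))%:E); last exact: ltry.
have c1 : (\int[P]_w (phi K (X w))%:E)%E @[K --> \oo] --> (\int[P]_w (expR (- u * X w))%:E)%E.
  rewrite (_ : (\int[P]_w (expR (- u * X w))%:E)%E =
      (\int[P]_w limn (fun K => (phi K (X w))%:E))%E).
    apply: cvg_monotone_convergence => //.
    - by move=> K; apply/measurable_EFinP; exact: measurableT_comp.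
    - by move=> K w _; rewrite lee_fin.
    - move=> w _ K L KL; rewrite lee_fin le_min !ge_min lexx/=.
      by rewrite ler_nat KL orbT.
  apply: eq_integral => w _; apply/esym/cvg_lim => //; apply: cvg_near_cst.
  near=> K; congr EFin; apply/min_idPl.
  by near: K; exact: nbhs_infty_ger.
by apply: cvge_to_le c1 _; apply: nearW.
Unshelve. all: by end_near. Qed.

End families.

(** * The subordinated compound Poisson process *)

Lemma expRE_nneseries (R : realType) (x : R) : 0 <= x ->
  (\sum_(n <oo) (exp_coeff x n)%:E = (expR x)%:E)%E.
Proof.
move=> x0; transitivity (limn (EFin \o series (exp_coeff x))).
  by apply/congr_lim/funext => n /=; rewrite /series/= sumEFin.
by rewrite EFin_lim//; exact: is_cvg_series_exp_coeff.
Qed.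

Lemma bernstein_gt0 (R : realType) (b s : R) (nu : {measure set R -> \bar R}) :
  0 <= b -> levy_measure_halfline nu -> nu `]0, +oo[%classic != 0%E ->
  0 < s -> 0 < bernstein b nu s.
Proof.
move=> b0 nul nu0 s0.
have pos_int : (0 < \int[nu]_(x in `]0%R, +oo[) (1 - expR (- (s * x)))%:E)%E.
  apply: integral_gt0 => //.
  - by apply: measurable_funB => //; apply: measurableT_comp => //; exact: measurableT_comp.
  - move=> x; rewrite /= in_itv/= andbT => x0.
    by rewrite subr_gt0 -[ltRHS]expR0 ltr_expR oppr_lt0 mulr_gt0.
rewrite /bernstein ltr_wpDl ?(mulr_ge0 b0 (ltW s0))//.
rewrite -lte_fin /Rintegral fineK//; apply: integrable_fin_num => //.
have := levy_measure_integrable_expRB1 nul (_ : - s <= 0).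
rewrite oppr_le0 ltW// => /(_ isT)/integrableN; apply: eq_integrable => // x _.
by rewrite /= opprB mulNr.
Qed.

Section compound.
Context d (T : measurableType d) (R : realType) (P : probability T R).
Context (b : R) (nu : {measure set R -> \bar R}) (lambda : R).
Context (D : R -> {RV P >-> R}) (N : R -> {RV P >-> nat}).
Context (X : {RV P >-> R}) (Xs : nat -> {RV P >-> R}).
Hypothesis b_ge0 : 0 <= b.
Hypothesis nu_levy : levy_measure_halfline nu.
Hypothesis nu_infinite : nu `]0, +oo[%classic = +oo%E.
Hypothesis D_subordinator : levy_subordinator D.
Hypothesis D_laplace : forall s t : R, 0 <= s -> 0 <= t ->
  (\int[P]_w (expR (- s * D t w))%:E = (expR (- t * bernstein b nu s))%:E)%E.
Hypothesis lambda_gt0 : 0 < lambda.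
Hypothesis N_poisson : poisson_process lambda N.
Hypothesis N_D_independent :
  independent_sigma P (sigma_of_family times N) (sigma_of_family times D).
Hypothesis Xs_iid : iid_copies X Xs.
Hypothesis Xs_Nf_independent :
  independent_sigma P (sigma_of_family [set: nat] Xs)
    (sigma_of_family times (subordinated_poisson N D)).

Local Notation Nf := (subordinated_poisson N D).
Local Notation Yf := (compound_process Nf Xs).

Let D0 w : D 0 w = 0.
Proof. exact: levy_start (subordinator_levy D_subordinator) w. Qed.

Let D_ge0 k w : 0 <= k -> 0 <= D k w.
Proof.
by move=> k0; rewrite -[leLHS](D0 w); apply: subordinator_nondecreasing.
Qed.

Let N_law s n : 0 < s -> P [set w | N s w = n] = (poisson_weight lambda n s)%:E.
Proof.
move=> s0; have := poisson_increments N_poisson n (lexx 0) s0.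
rewrite subr0 /poisson_pmf mulr_gt0// => <-; congr (P _).
have N0 := counting_start (poisson_counting N_poisson).
by apply/seteqP; split=> w /=; rewrite N0 subn0.
Qed.

Let N_D k s n B : 0 <= k -> 0 <= s -> measurable B ->
  (P ([set w | N s w = n] `&` D k @^-1` B) = P [set w | N s w = n] * P (D k @^-1` B))%E.
Proof.
move=> k0 s0 mB; apply: N_D_independent; last exact: sigma_of_family_preimage.
exact: (@sigma_of_family_preimage _ _ _ _ _ times (fun s => N s : T -> nat) s [set n]).
Qed.

Let N_rc : right_continuous_paths (fun t w => (N t w)%:R : R).
Proof. exact: counting_right_continuous (poisson_counting N_poisson). Qed.

Let mD k : measurable_fun setT (D k).
Proof. exact: measurable_funP. Qed.

Lemma measurable_subordinated_poisson k : 0 <= k -> measurable_fun setT (Nf k).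
Proof.
by move=> k0; apply: (measurable_random_time N_rc (mD k)) => w; exact: D_ge0.
Qed.

Lemma subordinated_poisson_law k n : 0 <= k ->
  P [set w | Nf k w = n] = (\int[P]_w (poisson_weight lambda n (D k w))%:E)%E.
Proof.
move=> k0; apply: (random_time_law N_rc (mD k) _ lambda_gt0) => //.
  by move=> w; exact: D_ge0.
by move=> *; exact: N_D.
Qed.

Let mNfset k n : 0 <= k -> measurable [set w | Nf k w = n].
Proof.
move=> k0; rewrite -[X in measurable X]setTI.
exact: (measurable_subordinated_poisson k0 measurableT (Y := [set n])).
Qed.

Let mS n : measurable_fun setT (fun w => \sum_(i < n) Xs i w).
Proof. by apply: measurable_sum => i. Qed.

Let YfE k n w : Nf k w = n -> Yf k w = \sum_(i < n) Xs i w.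
Proof. by rewrite /compound_process => ->. Qed.

Lemma measurable_compound k : 0 <= k -> measurable_fun setT (Yf k).
Proof.
move=> k0 _ B mB; rewrite setTI.
rewrite (_ : _ @^-1` B = \bigcup_n ([set w | Nf k w = n] `&`
    (fun w => \sum_(i < n) Xs i w) @^-1` B)).
  apply: bigcup_measurable => n _; apply: measurableI; first exact: mNfset.
  by rewrite -[X in measurable X]setTI; exact: mS.
apply/seteqP; split=> [w Bw|w [n _ [/= Nn Bn]]].
  by exists (Nf k w) => //; split.
by rewrite /= (YfE Nn).
Qed.

Section laplace.
Context (u : R).
Local Notation M := (\int[P]_w (expR (- u * X w))%:E)%E.
Local Notation ES n := (\int[P]_w (expR (- u * \sum_(i < n) Xs i w))%:E)%E.

Let mexpu : measurable_fun setT (fun x : R => (expR (- u * x))%:E).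
Proof. by apply/measurable_EFinP; exact: measurableT_comp. Qed.

Lemma compound_exp k : 0 <= k ->
  (\int[P]_w (expR (- u * Yf k w))%:E =
   \sum_(n <oo) P [set w | Nf k w = n] * ES n)%E.
Proof.
move=> k0; rewrite (@ge0_integral_partition _ _ _ P (Nf k))//; last 2 first.
- by move=> n; exact: mNfset.
- exact: (measurableT_comp mexpu (measurable_compound k0)).
apply: eq_eseriesr => n _.
transitivity (\int[P]_(w in [set w | Nf k w = n])
   (expR (- u * \sum_(i < n) Xs i w))%:E)%E.
  by apply: eq_integral => w /set_mem/= Nn; rewrite (YfE Nn).
apply: (@integral_indep_event _ T R P _ _ _ (fun w => \sum_(i < n) Xs i w)
   (fun x => (expR (- u * x))%:E)) => //.
- exact: mNfset.
- move=> B mB; rewrite setIC muleC; apply: Xs_Nf_independent.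
    exact: sigma_of_family_partial_sum.
  exact: (@sigma_of_family_preimage _ _ _ _ _ times (fun s => Nf s : T -> nat) k [set n]).
Qed.

Let ES_ge0 n : (0 <= ES n)%E.
Proof. by apply: integral_ge0 => w _; rewrite lee_fin expR_ge0. Qed.

(** Given D k, the sum over n of the Poisson weights times M^n is the exponential series of lambda D
    M times exp(-lambda D). All terms are nonnegative, so sum and expectation are exchanged without
    knowing that the result is finite. *)
Lemma compound_exp_mgf k : 0 <= k -> M \is a fin_num ->
  (\int[P]_w (expR (- u * Yf k w))%:E =
   \int[P]_w (expR (lambda * (fine M - 1) * D k w))%:E)%E.
Proof.
move=> k0 Mfin; have M0 : 0 <= fine M.
  by rewrite fine_ge0// integral_ge0// => w _; rewrite lee_fin expR_ge0.
pose y w := lambda * D k w * fine M.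
have y0 w : 0 <= y w by rewrite !mulr_ge0 ?(ltW lambda_gt0) ?D_ge0.
have my : measurable_fun setT y.
  by apply: measurable_funM => //; exact: measurable_funM.
have mterm n : measurable_fun setT (fun w => (exp_coeff (y w) n * expR (- (lambda * D k w)))%:E).
  apply/measurable_EFinP; apply: measurable_funM; last first.
    by apply: measurableT_comp => //; apply: measurableT_comp => //; exact: measurable_funM.
  by apply: measurable_funM => //; exact: measurable_funX.
have term0 n w : (0 <= (exp_coeff (y w) n * expR (- (lambda * D k w)))%:E)%E.
  by rewrite lee_fin mulr_ge0 ?expR_ge0 ?exp_coeff_ge0.
rewrite compound_exp//.
transitivity (\sum_(n <oo) \int[P]_w
    (exp_coeff (y w) n * expR (- (lambda * D k w)))%:E)%E.
  apply: eq_eseriesr => n _.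
  rewrite (expectation_exp_sum_iid _ Xs_iid)// subordinated_poisson_law//.
  rewrite -ge0_integralZr//; last 3 first.
  - apply/measurable_EFinP; apply: measurable_funM; last first.
      by apply: measurableT_comp => //; apply: measurableT_comp => //; exact: measurable_funM.
    by apply: measurable_funM => //; apply: measurable_funX; exact: measurable_funM.
  - move=> w _; rewrite lee_fin mulr_ge0 ?expR_ge0// divr_ge0// exprn_ge0//.
    by rewrite mulr_ge0 ?(ltW lambda_gt0) ?D_ge0.
  - by rewrite lee_fin exprn_ge0.
  apply: eq_integral => w _; rewrite -EFinM; congr EFin.
  by rewrite /poisson_weight /exp_coeff/= /y !exprMn; ring.
rewrite -integral_nneseries//.
apply: eq_integral => w _.
under eq_eseriesr do rewrite mulrC EFinM.
rewrite nneseriesZl; last by move=> n _; rewrite lee_fin exp_coeff_ge0.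
rewrite expRE_nneseries// -EFinM -expRD; congr ((expR _)%:E).
by rewrite /y; ring.
Qed.

(** P(Nf 1 = 0) = exp(-f(lambda)) < 1, because nu is nonzero and hence f(lambda) > 0. Some n.+1
    therefore has positive probability, the exponential moment of a sum of n.+1 jumps is finite, and
    so is that of one jump. *)
Lemma jump_exp_fin : (\int[P]_w (expR (- u * Yf 1 w))%:E < +oo)%E ->
  M \is a fin_num.
Proof.
move=> Yfin.
rewrite ge0_fin_numE; last by apply: integral_ge0 => w _; rewrite lee_fin expR_ge0.
have [n n1] : exists n, P [set w | Nf 1 w = n.+1] != 0%E.
  apply: contrapT => /forallNP Pn0.
  have Pn n : P [set w | Nf 1 w = n.+1] = 0%E by apply/eqP/negPn/negP; exact: Pn0.
  have P0 : P [set w | Nf 1 w = 0%N] = (expR (- bernstein b nu lambda))%:E.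
    rewrite subordinated_poisson_law//.
    have := D_laplace (ltW lambda_gt0) (ler01); rewrite mulN1r => <-.
    apply: eq_integral => w _.
    by rewrite /poisson_weight expr0 fact0 divr1 mul1r mulNr.
  have PT : (\sum_(n <oo) P [set w | Nf 1 w = n] = 1)%E.
    rewrite -(@probability_setT _ _ _ P) -[RHS]mul1e -integral_cst//.
    rewrite (@ge0_integral_partition _ T R P (Nf 1) (cst 1%E)) => [|n||]//.
      by apply: eq_eseriesr => n _; rewrite integral_cst ?mul1e//; exact: mNfset.
    exact: mNfset.
  move: PT; rewrite nneseries_recl//= P0 eseries0; last by case=> // n _ _; exact: Pn.
  rewrite adde0 => -[] /eqP; apply/negP; rewrite lt_eqF//.
  rewrite -[ltRHS]expR0 ltr_expR oppr_lt0; apply: bernstein_gt0 => //.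
  by rewrite nu_infinite.
have term : (P [set w | Nf 1 w = n.+1] * ES n.+1 < +oo)%E.
  apply: le_lt_trans Yfin; rewrite compound_exp//.
  apply: le_trans (nneseries_lim_ge n.+2 _); last by move=> m _ _; rewrite mule_ge0.
  rewrite [leRHS]big_nat_recr//= leeDr// sume_ge0// => m _.
  by apply: mule_ge0; [exact: measure_ge0|exact: ES_ge0].
apply: (@exp_moment_of_sum _ _ _ _ X Xs u n Xs_iid).
rewrite ltey; apply: contraTN term => /eqP ->.
by rewrite gt0_muley ?ltxx// lt0e n1 measure_ge0.
Qed.

Lemma compound_laplace (k : nat) :
  (forall j : nat, \int[P]_w (expR (- u * Yf j%:R w))%:E < +oo)%E ->
  (\int[P]_w (expR (- u * Yf k%:R w))%:E =
   (expR (- bernstein b nu (lambda * (1 - fine M))) ^+ k)%:E)%E.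
Proof.
move=> Yfin; have Mfin := jump_exp_fin (Yfin 1%N).
have k0 : 0 <= k%:R :> R by [].
have -> : expR (- bernstein b nu (lambda * (1 - fine M))) ^+ k =
    expR (- k%:R * bernstein b nu (lambda * (1 - fine M))).
  by rewrite -expRM_natl mulrN mulNr.
have := Yfin k; rewrite compound_exp_mgf//.
have -> : lambda * (fine M - 1) = - (lambda * (1 - fine M)) by ring.
set s := lambda * (1 - fine M) => sfin.
have [s0|s0] := leP 0 s; first exact: D_laplace.
(* The extension to negative s needs a positive time, so k = 0 is settled separately by D 0 = 0. *)
case: k {k0} sfin => [|k] sfin.
  rewrite oppr0 mul0r expR0; transitivity (\int[P]_w (cst 1 w))%E.
    by apply: eq_integral => w _; rewrite D0 mulr0 expR0.
  rewrite integral_cst// mul1e; exact: (@probability_setT _ _ _ P).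
rewrite -[in RHS](opprK s).
apply: laplace_bernstein_neg => //.
- by move=> w; exact: D_ge0.
- by move=> s' s'0; exact: D_laplace.
- by rewrite oppr_gt0.
Qed.

End laplace.
End compound.

(** * The geometric counting process *)

Lemma integral_exp_half_line (R : realType) (c : R) : 0 < c ->
  (\int[lebesgue_measure]_(x in `]0%R, +oo[) (expR (- c * x))%:E = (c^-1)%:E)%E.
Proof.
move=> c0.
have mpdf : measurable_fun setT (EFin \o (exponential_pdf c)).
  by apply/measurable_EFinP; exact: measurable_exponential_pdf.
have := integral_exponential_pdf c0.
rewrite (_ : (\int[lebesgue_measure]_x (exponential_pdf c x)%:E)%E =
  (c%:E * \int[lebesgue_measure]_(x in `]0%R, +oo[) (expR (- c * x))%:E)%E).
  move/(congr1 (fun z => (c^-1)%:E * z)%E).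
  by rewrite muleA -EFinM mulVf ?gt_eqF// mul1e mule1.
rewrite integral_itv_obnd_cbnd; last first.
  by apply/measurable_EFinP; exact: measurableT_comp.
rewrite -ge0_integralZl//=; last 2 first.
- by apply/measurable_EFinP; exact: measurableT_comp.
- by rewrite lee_fin ltW.
rewrite [RHS]integral_mkcond; apply: eq_integral => x _.
by rewrite /exponential_pdf restrict_EFin.
Qed.

Section geometric.
Context d (T : measurableType d) (R : realType) (P : probability T R).
Context (mu : R) (G : R -> {RV P >-> nat}).
Hypothesis mu_gt0 : 0 < mu.
Hypothesis G_geometric : geometric_counting_process mu G.
Context (t : R) (t_gt0 : 0 < t).

Local Notation pos := (`]0, +oo[%classic : set R).

Let mintegrand k : measurable_fun pos
  (fun x => mu^-1 * expR (- mu^-1 * x) * (exp_coeff (x * t) k * expR (- (x * t)))).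
Proof.
apply: measurable_funM.
  by apply: measurable_funM => //; exact: measurableT_comp.
apply: measurable_funM.
  apply: measurable_funM => //; apply: measurable_funX; exact: measurable_funM.
apply: measurableT_comp => //; apply: measurableT_comp => //; exact: measurable_funM.
Qed.

(** The Poisson mass is mixed over the exponential rate. Restricting to L > 0 loses no probability
    and keeps [poisson_pmf] to positive parameters, where it is the usual formula. *)
Lemma geometric_pmfE k : P [set w | G t w = k] =
  (\int[lebesgue_measure]_(x in pos)
     (mu^-1 * expR (- mu^-1 * x) * (exp_coeff (x * t) k * expR (- (x * t))))%:E)%E.
Proof.
have [L [Llaw [[G0 _ _] Lpos Linc]]] := G_geometric.
have mpos : measurable pos by exact: measurable_itv.
have mLpos : measurable (L @^-1` pos).
  by rewrite -[X in measurable X]setTI; exact: measurable_funP.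
have mGk : measurable [set w | G t w = k].
  suff : measurable (G t @^-1` [set k]) by [].
  by rewrite -[X in measurable X]setTI; exact: measurable_funP.
have -> : P [set w | G t w = k] = P (L @^-1` pos `&` [set w | G t w = k]).
  apply/eqP; rewrite eq_le; apply/andP; split; last first.
    by apply: le_measure; rewrite ?inE//; exact: measurableI.
  have LC0 : P (~` (L @^-1` pos)) = 0%E by rewrite probability_setC// Lpos subee.
  have mLC : measurable (~` (L @^-1` pos)) by exact: measurableC.
  rewrite -[leRHS]adde0 -LC0.
  apply: le_trans (measureU2 _ (measurableI _ _ mLpos mGk) mLC).
  apply: le_measure; rewrite ?inE//; first by apply: measurableU => //; exact: measurableI.
  by move=> w Gk; have [Lw|Lw] := pselect ((L @^-1` pos) w); [left|right].
(* With tau i = i t and n = 1, only the increment from 0 to t is constrained; t > 0 makes these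
   times strictly increasing. *)
have tau0 : 0 <= (0%:R * t : R) by rewrite mul0r.
have tauS i : (fun i : nat => i%:R * t) i < (fun i : nat => i%:R * t) i.+1.
  by rewrite /= ltr_pM2r// ltr_nat.
have := Linc 1%N (fun i => i%:R * t) (fun=> k) pos tau0 tauS mpos.
rewrite (_ : [set w | _] = [set w | G t w = k]); last first.
  apply/seteqP; split=> w /=.
    by move=> /(_ 0%N isT); rewrite mul0r mul1r G0 subn0.
  by move=> Gk [|//] _; rewrite mul0r mul1r G0 subn0.
move=> ->.
have ge0_mu : 0 <= mu^-1 by rewrite invr_ge0 ltW.
have mpdf := measurable_exponential_pdf mu^-1.
pose phi x := (\prod_(i < 1) poisson_pmf (x * (i.+1%:R * t - i%:R * t)) k : R).
have phiE x : phi x = poisson_pmf (x * t) k.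
  by rewrite /phi big_ord1 mul0r mul1r subr0.
rewrite [LHS]integral_mkcond.
(* The law of L is the image under the identity of Lebesgue measure weighted by the exponential
   density. *)
transitivity (\int[lebesgue_measure]_x
    ((exponential_pdf mu^-1 x)%:E * ((fun x => (phi x)%:E) \_ pos) x))%E.
  apply: (@ge0_integral_weighted_pushforward _ _ R lebesgue_measure _ _ (distribution P L) id
    (exponential_pdf mu^-1)) => //.
  - by move=> x; exact: exponential_pdf_ge0.
  - apply/(measurable_restrictT _ mpos); apply/measurable_EFinP.
    apply: measurable_funTS; rewrite (_ : (fun x => _) = phi)//.
    rewrite (_ : phi = (fun x => poisson_pmf x k) \o (fun x => x * t)); last first.
      by apply/funext => x; rewrite phiE.
    apply: measurableT_comp; last exact: measurable_funM.
    exact: measurable_poisson_pmf.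
  - move=> x; apply: erestrict_ge0 => {}x _.
    by rewrite -/(phi x) phiE lee_fin poisson_pmf_ge0.
rewrite [RHS]integral_mkcond; apply: eq_integral => x _.
rewrite !patchE; case: ifPn => [/set_mem|_]; last by rewrite mule0.
rewrite /= in_itv/= andbT => x0.
rewrite -EFinM -/(phi x) phiE exponential_pdfE ?ltW// /poisson_pmf mulr_gt0//.
Qed.

Lemma geometric_pmf_gt0 k : P [set w | G t w = k] != 0%E.
Proof.
rewrite geometric_pmfE gt_eqF//; apply: integral_gt0 => //.
- exact: mintegrand.
- move=> x; rewrite /= in_itv/= andbT => x0.
  by rewrite !mulr_gt0 ?expR_gt0 ?invr_gt0 ?ltr0n ?fact_gt0 ?exprn_gt0 ?mulr_gt0//.
- by apply/eqP => /=; rewrite lebesgue_measure_itv/= ltry.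
Qed.

(** Summing the exponential series under the integral leaves mu^-1 times the integral of exp(-cx),
    where mu c = 1 + mu t (1 - r). Since r may exceed 1, c may be nonpositive; the integral is then
    infinite, which the finiteness hypothesis excludes. *)
Lemma geometric_pgf (r : R) : 0 <= r ->
  (\sum_(k <oo) P [set w | G t w = k] * (r ^+ k)%:E < +oo)%E ->
  (\sum_(k <oo) P [set w | G t w = k] * (r ^+ k)%:E =
    ((1 + mu * t * (1 - r))^-1)%:E)%E.
Proof.
move=> r0.
pose c := mu^-1 + t * (1 - r).
have -> : (\sum_(k <oo) P [set w | G t w = k] * (r ^+ k)%:E =
   (mu^-1)%:E * \int[lebesgue_measure]_(x in pos) (expR (- c * x))%:E)%E.
  have integrand0 k x : pos x -> (0 <= (mu^-1 * expR (- mu^-1 * x) *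
      (exp_coeff (x * t) k * expR (- (x * t))))%:E)%E.
    rewrite /= in_itv/= andbT => /ltW x0.
    have xt0 : 0 <= x * t by rewrite mulr_ge0// ltW.
    have mui0 : 0 <= mu^-1 by rewrite invr_ge0 ltW.
    by rewrite lee_fin mulr_ge0// mulr_ge0 ?expR_ge0// exp_coeff_ge0.
  transitivity (\sum_(k <oo) \int[lebesgue_measure]_(x in pos)
     (mu^-1 * expR (- mu^-1 * x) * (exp_coeff (x * t) k * expR (- (x * t))) * r ^+ k)%:E)%E.
    apply: eq_eseriesr => k _; rewrite geometric_pmfE -ge0_integralZr//.
    - by apply/measurable_EFinP; exact: mintegrand.
    - by move=> x; exact: integrand0.
    - by rewrite lee_fin exprn_ge0.
  rewrite -integral_nneseries//; last 2 first.
  - by move=> k; apply/measurable_EFinP; apply: measurable_funM => //; exact: mintegrand.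
  - by move=> k x px; rewrite EFinM mule_ge0 ?integrand0// lee_fin exprn_ge0.
  rewrite -ge0_integralZl//; last 2 first.
  - by apply/measurable_EFinP; exact: measurableT_comp.
  - by rewrite lee_fin invr_ge0 ltW.
  apply: eq_integral => x /set_mem; rewrite /= in_itv/= andbT => /ltW x0.
  have xtr0 : 0 <= x * t * r by rewrite !mulr_ge0 ?(ltW t_gt0).
  transitivity (\sum_(k <oo) (mu^-1 * expR (- mu^-1 * x) * expR (- (x * t)))%:E *
     (exp_coeff (x * t * r) k)%:E)%E.
    apply: eq_eseriesr => k _; rewrite -EFinM; congr EFin.
    by rewrite /exp_coeff/= !exprMn; ring.
  rewrite nneseriesZl; last by move=> k _; rewrite lee_fin exp_coeff_ge0.
  rewrite expRE_nneseries// -!EFinM -!mulrA -!expRD; congr ((_ * expR _)%:E).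
  by rewrite /c; ring.
have [c0|c0] := ltP 0 c.
  rewrite integral_exp_half_line// -EFinM -invfM => _; congr ((_^-1)%:E).
  by rewrite /c mulrDr divff ?gt_eqF//; ring.
move=> fin; exfalso; move: fin; apply/negP; rewrite -leNgt leye_eq.
have -> : (\int[lebesgue_measure]_(x in pos) (expR (- c * x))%:E = +oo)%E.
  apply/eqP; rewrite -leye_eq.
  apply: (@le_trans _ _ (\int[lebesgue_measure]_(x in pos) (cst 1 x))%E).
    by rewrite integral_cst//= lebesgue_measure_itv/= ltry mul1e.
  apply: ge0_le_integral => //.
  - by apply/measurable_EFinP; exact: measurableT_comp.
  - move=> x; rewrite /= in_itv/= andbT => x0.
    by rewrite lee_fin -[leLHS]expR0 ler_expR mulr_ge0 ?(ltW x0)// oppr_ge0.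
by rewrite gt0_muley// lte_fin invr_gt0.
Qed.

End geometric.

(* The jumps are real-valued, so E[exp(-u Y)] may be infinite (in which case the
   closed form has no meaning); it is assumed to be finite.  For nonnegative jumps
   this holds for every t >= 0 and u > 0, the integrand being at most 1. *)
Theorem proposition4p2 (d : measure_display) (T : measurableType d)
    (R : realType) (P : probability T R)
    (b : R) (nu : {measure set R -> \bar R}) (lambda mu : R)
    (D : R -> {RV P >-> R}) (N : R -> {RV P >-> nat})
    (X : {RV P >-> R}) (Xs : nat -> {RV P >-> R})
    (G : R -> {RV P >-> nat})
    (b_ge0 : 0 <= b)
    (nu_levy : levy_measure_halfline nu)
    (nu_infinite : nu `]0, +oo[%classic = +oo%E)
    (D_subordinator : levy_subordinator D)
    (D_laplace : forall s t : R, 0 <= s -> 0 <= t ->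
       ('E_P[fun w => expR (- s * D t w)])%E =
       (expR (- t * bernstein b nu s))%:E)
    (lambda_gt0 : 0 < lambda)
    (N_poisson : poisson_process lambda N)
    (N_D_independent :
       independent_sigma P (sigma_of_family times N) (sigma_of_family times D))
    (Xs_iid : iid_copies X Xs)
    (Xs_Nf_independent :
       independent_sigma P (sigma_of_family [set: nat] Xs)
         (sigma_of_family times (subordinated_poisson N D)))
    (mu_gt0 : 0 < mu)
    (G_geometric : geometric_counting_process mu G)
    (G_Yf_independent :
       independent_sigma P (sigma_of_family times G)
         (sigma_of_family times
            (compound_process (subordinated_poisson N D) Xs)))
    (t u : R) (t_ge0 : 0 <= t) (u_gt0 : 0 < u) :
  let Ymu :=
    geometric_subordinated (compound_process (subordinated_poisson N D) Xs) G in
  ('E_P[fun w => expR (- u * Ymu t w)] < +oo)%E ->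
  ('E_P[fun w => expR (- u * Ymu t w)])%E =
  ((1 + mu * t *
      (1 - expR (- bernstein b nu
                     (lambda * (1 - fine ('M_P X (- u)))))))^-1)%:E.
Proof.
move=> Ymu; rewrite unlock => Yfin.
set Yf := compound_process (subordinated_poisson N D) Xs.
have D_lap s' t' : 0 <= s' -> 0 <= t' ->
    (\int[P]_w (expR (- s' * D t' w))%:E = (expR (- t' * bernstein b nu s'))%:E)%E.
  by move=> s0 t0; have := D_laplace s' t' s0 t0; rewrite unlock.
have G0 w : G 0 w = 0%N by case: G_geometric => L [_ [[G0 _ _] _ _]]; exact: G0.
(* At t = 0 the process vanishes and both sides are 1. For t > 0 all masses of G t are positive, on
   which the finiteness of the conditional expectations rests. *)
have := t_ge0; rewrite le_eqVlt => /predU1P[t0|t_gt0].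
  have Y0 w : Ymu t w = 0.
    rewrite /Ymu /geometric_subordinated -t0 G0 /compound_process /subordinated_poisson.
    rewrite (levy_start (subordinator_levy D_subordinator)).
    by rewrite (counting_start (poisson_counting N_poisson)) big_ord0.
  transitivity (\int[P]_w cst 1 w)%E.
    by apply: eq_integral => w _; rewrite Y0 mulr0 expR0.
  rewrite integral_cst// mul1e -t0 mulr0 mul0r addr0 invr1.
  exact: (@probability_setT _ _ _ P).
have mYf k : 0 <= k -> measurable_fun setT (Yf k).
  exact: (measurable_compound Xs D_subordinator N_poisson).
have mG k : measurable [set w | G t w = k].
  suff : measurable (G t @^-1` [set k]) by [].
  by rewrite -[X in measurable X]setTI; exact: measurable_funP.
have mYmu : measurable_fun setT (Ymu t).
  move=> _ B mB; rewrite setTI.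
  rewrite (_ : _ @^-1` B = \bigcup_k ([set w | G t w = k] `&` Yf k%:R @^-1` B)).
    apply: bigcup_measurable => k _; apply: measurableI => //.
    by rewrite -[X in measurable X]setTI; exact: mYf.
  apply/seteqP; split=> [w Bw|w [k _ [/= Gk Bk]]]; first by exists (G t w).
  by rewrite /= /Ymu /geometric_subordinated Gk.
have mexp : measurable_fun setT (fun x : R => (expR (- u * x))%:E).
  by apply/measurable_EFinP; exact: measurableT_comp.
have totalE : (\int[P]_w (expR (- u * Ymu t w))%:E =
    \sum_(k <oo) P [set w | G t w = k] * \int[P]_w (expR (- u * Yf k%:R w))%:E)%E.
  rewrite (@ge0_integral_partition _ _ _ P (G t))//; last first.
    exact: (measurableT_comp mexp mYmu).
  apply: eq_eseriesr => k _.
  transitivity (\int[P]_(w in [set w | G t w = k]) (expR (- u * Yf k%:R w))%:E)%E.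
    by apply: eq_integral => w /set_mem/= Gk; rewrite /Ymu /geometric_subordinated Gk.
  apply: (@integral_indep_event _ T R P _ _ _ (Yf k%:R) (fun x => (expR (- u * x))%:E)) => //.
  - exact: mYf.
  - move=> B mB; apply: G_Yf_independent.
      exact: (@sigma_of_family_preimage _ _ _ _ _ times (fun s => G s : T -> nat) t [set k]).
    apply: (@sigma_of_family_preimage _ _ _ _ _ times Yf k%:R B) => //; exact: ler0n.
have Y_ge0 k : (0 <= \int[P]_w (expR (- u * Yf k%:R w))%:E)%E.
  by apply: integral_ge0 => w _; rewrite lee_fin expR_ge0.
have Yk_fin k : (\int[P]_w (expR (- u * Yf k%:R w))%:E < +oo)%E.
  (* One term of a convergent series of nonnegative terms; its factor P(G t = k) is nonzero, so the
     other factor cannot be +oo. *)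
  have term : (P [set w | G t w = k] * \int[P]_w (expR (- u * Yf k%:R w))%:E < +oo)%E.
    apply: le_lt_trans Yfin; rewrite totalE.
    apply: le_trans (nneseries_lim_ge k.+1 _); last by move=> m _ _; rewrite mule_ge0.
    rewrite [leRHS]big_nat_recr//= leeDr// sume_ge0// => m _.
    by apply: mule_ge0; [exact: measure_ge0|exact: Y_ge0].
  rewrite ltey; apply: contraTN term => /eqP ->.
  by rewrite gt0_muley ?ltxx// lt0e (geometric_pmf_gt0 mu_gt0 G_geometric t_gt0) measure_ge0.
have ME : 'M_P X (- u) = (\int[P]_w (expR (- u * X w))%:E)%E.
  by rewrite /mmt_gen_fun unlock; apply: eq_integral => w _; rewrite /= mulrC.
have lapE k := compound_laplace b_ge0 nu_levy nu_infinite D_subordinator D_lap lambda_gt0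
  N_poisson N_D_independent Xs_iid Xs_Nf_independent k Yk_fin.
move: Yfin; rewrite totalE ME; under eq_eseriesr do rewrite lapE.
by move=> fin; apply: (geometric_pgf mu_gt0 G_geometric t_gt0) fin; exact: expR_ge0.
Qed.
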